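(* Fix $1\le p_0<q<q_0\le\infty$ and let $\mathbb B=(B_Q)_{Q\in\mathcal Q}$ satisfy conditions (b) and (c) below. Assume further that for all cubes $R\subset Q$, $A_RA_Qf(x)=A_Qf(x)$ for a.e. $x\in2R$, and that each $A_Q$ is local: $A_Qf=\chi_{2Q}\,A_Q(f\chi_{2Q})$ for every cube $Q$. Let $f\in L^{p_0}_{loc}(\mathbb R^n)$ and let $a$ be a functional such that for every cube $Q$, $$\Big(\fint_{2Q}|B_Qf|^{p_0}\,dx\Big)^{1/p_0}\le a(2Q).$$ If $a\in D_q$, then for every cube $Q$, $\|B_Qf\|_{L^{q,\infty},Q}\le C\,a(2Q)$, with $C$ independent of $Q$ and $f$.
   Context: Cubes $Q=\prod_i[a_i,a_i+\ell(Q))$; $\lambda Q$ is the concentric cube of sidelength $\lambda\ell(Q)$; $\mathcal Q$ is the set of all cubes; $\fint_Eg=|E|^{-1}\int_Eg$; $\|g\|_{L^{q,\infty},Q}=\sup_{t>0}t(|\{x\in Q:|g(x)|>t\}|/|Q|)^{1/q}$. A functional is a map $a:\mathcal Q\to[0,\infty)$. $\mathbb B=(B_Q)_{Q\in\mathcal Q}$ are linear operators defined on $L^{p_0}_{loc}(\mathbb R^n)$ and $A_Q=I-B_Q$. Condition (b): there is $C_{p_0}$ with $\|B_Qf\|_{L^{p_0}(\mathbb R^n)}\le C_{p_0}\|f\|_{L^{p_0}(\mathbb R^n)}$ for all cubes $Q$. Condition (c): there are $\alpha_k\ge0$, $k\ge2$, with $\sum_k2^{kn/p_0}\alpha_k<\infty$,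 such that for every cube $Q$, $(\fint_{2Q}|A_Q(f\chi_{4Q})|^{q_0})^{1/q_0}\le\alpha_2(\fint_{4Q}|f|^{p_0})^{1/p_0}$ and, for all $j\ge1$, $(\fint_{2^jQ}|A_Q(f\chi_{\mathbb R^n\setminus2^{j+1}Q})|^{q_0})^{1/q_0}\le\sum_{k\ge2}\alpha_{k+j}(\fint_{2^{k+j}Q}|f|^{p_0})^{1/p_0}$ (essential suprema when $q_0=\infty$). $a\in D_q$ means there is $C\ge1$ such that $\sum_ia(Q_i)^q|Q_i|\le C^qa(Q)^q|Q|$ for every cube $Q$ and every family of pairwise disjoint cubes $Q_i\subset Q$. *)

(* Defs.v *)
From HB Require Import structures.
From mathcomp Require Import all_boot all_order all_algebra.
From mathcomp Require Import all_classical all_reals all_analysis.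
Import Order.TTheory GRing.Theory Num.Theory.
Import numFieldNormedType.Exports.

Set Implicit Arguments.
Unset Strict Implicit.
Unset Printing Implicit Defensive.

Local Open Scope classical_set_scope.
Local Open Scope ring_scope.

Section Defs.
Context {R : realType}.

(** * Lebesgue measure on R^n = n.-tuple R (with its product = Borel sigma-algebra),
    defined as the iterated product measure:
      |A|_0 = Dirac mass at the unique point of R^0,
      |A|_{n+1} = \int_R |{t in R^n : (x :: t) in A}|_n dx. *)
Fixpoint lebRn (n : nat) : set (n.-tuple R) -> \bar R :=
  match n return set (n.-tuple R) -> \bar R with
  | 0 => fun A => (\1_A [tuple])%:E
  | m.+1 => fun A =>
      (\int[@lebesgue_measure R]_x @lebRn m (fun t => A [tuple of x :: t]))%E
  end.
Arguments lebRn : clear implicits.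

Definition cube (n : nat) := (n.-tuple R * R)%type.
Definition corner n (Q : cube n) : n.-tuple R := Q.1.
Definition side n (Q : cube n) : R := Q.2.
Definition is_cube n (Q : cube n) : Prop := 0 < side Q.

Definition cubeset n (Q : cube n) : set (n.-tuple R) :=
  [set x | forall i : 'I_n,
     tnth (corner Q) i <= tnth x i /\ tnth x i < tnth (corner Q) i + side Q].

(** lam Q : the concentric cube of sidelength lam * l(Q). *)
Definition dilate n (lam : R) (Q : cube n) : cube n :=
  ([tuple tnth (corner Q) i - (lam - 1) * side Q / 2 | i < n], lam * side Q).

Definition restr n (E : set (n.-tuple R)) (f : n.-tuple R -> R) : n.-tuple R -> R :=
  fun x => \1_E x * f x.

Definition ae_on n (E : set (n.-tuple R)) (P : n.-tuple R -> Prop) : Prop :=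
  exists N : set (n.-tuple R), measurable N /\ lebRn n N = 0%E /\
    forall x, E x -> ~ N x -> P x.

Definition Lploc n (p : R) (f : n.-tuple R -> R) : Prop :=
  measurable_fun setT f /\
  forall Q : cube n, is_cube Q ->
    (\int[lebRn n]_(x in cubeset Q) (`|f x| `^ p)%:E < +oo)%E.

Definition Lp n (p : R) (f : n.-tuple R -> R) : Prop :=
  measurable_fun setT f /\ (\int[lebRn n]_x (`|f x| `^ p)%:E < +oo)%E.

Definition Lpnorm n (p : R) (f : n.-tuple R -> R) : \bar R :=
  ((\int[lebRn n]_x (`|f x| `^ p)%:E) `^ p^-1)%E.

Definition avgp n (p : R) (E : set (n.-tuple R)) (g : n.-tuple R -> R) : \bar R :=
  ((((fine (lebRn n E))^-1)%:E * \int[lebRn n]_(x in E) (`|g x| `^ p)%:E) `^ p^-1)%E.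

Definition esssup_on n (E : set (n.-tuple R)) (g : n.-tuple R -> R) : \bar R :=
  ereal_inf [set y : \bar R | ae_on E (fun x => (`|g x|%:E <= y)%E)].

Definition avgq n (q : \bar R) (E : set (n.-tuple R)) (g : n.-tuple R -> R) : \bar R :=
  match q with
  | r%:E => avgp r E g
  | _ => esssup_on E g
  end.

Definition weaknorm n (q : R) (Q : cube n) (g : n.-tuple R -> R) : \bar R :=
  ereal_sup [set (t%:E * ((lebRn n (cubeset Q `&` [set x | (t < `|g x|)%R])
                   * ((fine (lebRn n (cubeset Q)))^-1)%:E) `^ q^-1))%E
            | t in [set t : R | 0 < t]].

Definition Aop n (B : cube n -> (n.-tuple R -> R) -> n.-tuple R -> R)
  (Q : cube n) (f : n.-tuple R -> R) : n.-tuple R -> R :=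
  fun x => f x - B Q f x.

(** The B_Q are linear operators on L^{p0}_loc (equalities of classes, i.e. a.e.),
    with measurable values. *)
Definition linear_family n (p0 : R) (B : cube n -> (n.-tuple R -> R) -> n.-tuple R -> R) :=
  forall Q : cube n, is_cube Q ->
    (forall f, Lploc p0 f -> measurable_fun setT (B Q f)) /\
    (forall f g, Lploc p0 f -> Lploc p0 g ->
       ae_on setT (fun x => B Q (fun y => f y + g y) x = B Q f x + B Q g x)) /\
    (forall (c : R) f, Lploc p0 f ->
       ae_on setT (fun x => B Q (fun y => c * f y) x = c * B Q f x)).

Definition cond_b n (p0 : R) (B : cube n -> (n.-tuple R -> R) -> n.-tuple R -> R) :=
  exists C : R, forall Q : cube n, is_cube Q -> forall f, Lp p0 f ->
    (Lpnorm p0 (B Q f) <= C%:E * Lpnorm p0 f)%E.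

Definition cond_c n (p0 : R) (q0 : \bar R)
  (B : cube n -> (n.-tuple R -> R) -> n.-tuple R -> R) :=
  exists alpha : nat -> R,
    (forall k, (2 <= k)%N -> 0 <= alpha k) /\
    (\sum_(2 <= k <oo) ((2 `^ (k%:R * n%:R / p0)) * alpha k)%:E < +oo)%E /\
    forall Q : cube n, is_cube Q -> forall f, Lploc p0 f ->
      (avgq q0 (cubeset (dilate 2 Q)) (Aop B Q (restr (cubeset (dilate 4 Q)) f))
         <= (alpha 2%N)%:E * avgp p0 (cubeset (dilate 4 Q)) f)%E /\
      (forall j : nat, (1 <= j)%N ->
        (avgq q0 (cubeset (dilate (2 ^+ j) Q))
            (Aop B Q (restr (~` cubeset (dilate (2 ^+ j.+1) Q)) f))
         <= \sum_(2 <= k <oo)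
              (alpha (k + j)%N)%:E * avgp p0 (cubeset (dilate (2 ^+ (k + j)) Q)) f)%E).

Definition Dq n (q : R) (a : cube n -> R) :=
  exists C : R, 1 <= C /\
    forall Q : cube n, is_cube Q ->
    forall F : set (cube n),
      (forall P, F P -> is_cube P /\ cubeset P `<=` cubeset Q) ->
      (forall P P', F P -> F P' -> P <> P' -> cubeset P `&` cubeset P' = set0) ->
      (\esum_(P in F) ((a P `^ q)%:E * lebRn n (cubeset P))
         <= ((C `^ q) * (a Q `^ q))%:E * lebRn n (cubeset Q))%E.

End Defs.

(* Main.v *)
Require Import Defs.
From HB Require Import structures.
From mathcomp Require Import all_boot all_order all_algebra.
From mathcomp Require Import all_classical all_reals all_analysis.
From mathcomp Require Import measurable_realfun ring lra.
Import Order.TTheory GRing.Theory Num.Theory.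
Import numFieldNormedType.Exports.

(** On a cube [P] inside [Q] split [g := B_Q f] over [2P] as [u + v] with [u := B_P f] and
    [v := A_P g]; this is exact because [A_P A_Q f = A_Q f] on [2P].  The hypothesis on [a]
    bounds the [L^p0] average of [u] by [a (2P)], and, [A_P] being local, (c) bounds the
    [L^q0] average of [v] over [2P] by the [L^p0] average of [g] over the same cube.  From
    these splittings alone one gets a good-lambda inequality
      |Omega_(L t)| <= c |Omega_t| + C (a (2Q) / t)^q |Q|,   c L^q <= 1/2,
    where [Omega_t] is the union of the maximal dyadic subcubes [P] of [Q], of generation at
    most [m], on which the [L^p0] average of [g] over [2P] exceeds [t]: subcubes with
    [a (2P) <= e t] are controlled by the splitting and a weak (1,1) estimate, the others by
    [D_q] applied to a Vitali subfamily of the [2P].  All families are finite and all bounds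
    uniform in [m]; level sets of [g] are compared to [Omega_t] by approximating them with
    finite unions of dyadic cubes. *)

Set Implicit Arguments.
Unset Strict Implicit.
Unset Printing Implicit Defensive.
Local Open Scope classical_set_scope.
Local Open Scope ring_scope.

(** * Lebesgue measure on tuples *)

(** The window p0 < q < r shapes the argument, where r is q0, or q + 1 when q0 is infinite. In the
    good-lambda constant the part [v] costs a multiple of L^(-r), which L^q cannot offset once L is
    large; the part [u] costs a multiple of e^p L^(-p), made small by choosing e after L. The main
    geometric obstacle is the doubling: the information about [u], [v] and [a] lives on the cubes
    2P, which overlap even when the cubes P are disjoint, while summing integrals and using D_q both
    need disjoint families. Each Vitali selection repairs this at the price 3^n. Locality serves
    twice. It makes A_Q f vanish a.e. off 2Q, so that B_Q f is in L^p0_loc and the B_P may be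
    applied to it; and on 2P it replaces g by its restriction to 2P, for which the first inequality
    of (c) has an average over 4P controlled by the average over 2P. The weak-type bound is
    propagated upwards through the levels A, A L, A L^2, ... with A = a(2Q), starting where the
    trivial bound |Omega_t| <= |Q| suffices. *)

Section as_sigma_finite.
Context d (T : measurableType d) (R : realType) (mu : {measure set T -> \bar R}).

(** An alias of [mu] carrying a proof as parameter: it turns sigma-finiteness known as a proposition
    into the structure that product measures ask for. *)
Definition as_sigma_finite (_ : sigma_finite setT mu) : set T -> \bar R := mu.

Variable sf : sigma_finite setT mu.
HB.instance Definition _ := Measure.on (as_sigma_finite sf).
HB.instance Definition _ :=
  Measure_isSigmaFinite.Build _ _ _ (as_sigma_finite sf) sf.

End as_sigma_finite.

Section lebRn_measure.
Context {R : realType}.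
Implicit Types n : nat.

Definition tuple_cons_pair n (p : R * n.-tuple R) : n.+1.-tuple R :=
  [tuple of p.1 :: p.2].

Lemma measurable_tuple_cons_pair n : measurable_fun setT (@tuple_cons_pair n).
Proof. exact: (measurable_cons measurable_fst measurable_snd). Qed.

(** The recursive clause integrates the measures of the sections of [A] along the first coordinate,
    which is how the product measure is defined. *)
Lemma lebRnS n (mu : {sigma_finite_measure set (n.-tuple R) -> \bar R}) :
  (mu : set _ -> \bar R) = @lebRn R n ->
  @lebRn R n.+1 = pushforward (@lebesgue_measure R \x mu)%E (@tuple_cons_pair n).
Proof.
move=> muE; apply/funext => A; rewrite /pushforward /product_measure1 /=.
apply: eq_integral => x _ /=; rewrite -muE; congr (mu _).
by apply/seteqP; split=> t; rewrite /xsection /= in_setE.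
Qed.

Lemma measurable_cubeset n (Q : @cube R n) : measurable (cubeset Q).
Proof.
have -> : cubeset Q = \bigcap_(i in [set: 'I_n])
    ((fun x : n.-tuple R => tnth x i) @^-1`
       `[tnth (corner Q) i, tnth (corner Q) i + side Q[%classic).
  apply/seteqP; split=> x Hx i; first by move=> _ /=; rewrite in_itv/=; apply/andP; exact: Hx.
  by have := Hx i I; rewrite /= in_itv/= => /andP.
apply: fin_bigcap_measurable; first exact: finite_finset.
by move=> i _; rewrite -[X in measurable X]setTI; apply: measurable_tnth.
Qed.

Lemma lebRn_cubeset_aux n (mu : {sigma_finite_measure set (n.-tuple R) -> \bar R}) :
  (mu : set _ -> \bar R) = @lebRn R n ->
  (forall Q : @cube R n, 0 <= side Q -> @lebRn R n (cubeset Q) = (side Q ^+ n)%:E) ->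
  forall Q : @cube R n.+1, 0 <= side Q -> @lebRn R n.+1 (cubeset Q) = (side Q ^+ n.+1)%:E.
Proof.
move=> muE IH Q Q0.
rewrite (lebRnS muE) /pushforward.
have E j : tnth (corner Q) (lift ord0 j) = tnth [tuple of behead (corner Q)] j.
  by rewrite {1}(tuple_eta (corner Q)) tnthS.
pose Q' : @cube R n := ([tuple of behead (corner Q)], side Q).
have -> : @tuple_cons_pair n @^-1` cubeset Q =
    `[tnth (corner Q) ord0, tnth (corner Q) ord0 + side Q[%classic `*` cubeset Q'.
  apply/seteqP; split=> [[x t]|[x t]] /=.
    move=> H; split; first by rewrite in_itv/=; apply/andP; have := H ord0.
    move=> i; have := H (lift ord0 i).
    by rewrite /tuple_cons_pair tnthS E.
  rewrite in_itv /= => -[/andP[H1 H2] H3] i.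
  case: (unliftP ord0 i) => [j ->|-> //].
  move: (H3 j).
  by rewrite /tuple_cons_pair tnthS E.
rewrite product_measure1E//; [|exact: measurable_cubeset].
rewrite [X in (X * _)%E]lebesgue_measure_itv /= lte_fin.
have -> : mu (cubeset Q') = (side Q ^+ n)%:E by rewrite muE IH.
rewrite ltrDl; case: ltrP => H.
  by rewrite -EFinD (addrC _ (side Q)) addrK -EFinM exprS.
have -> : side Q = 0 by apply/eqP; rewrite eq_le H Q0.
by rewrite mul0e exprS mul0r.
Qed.


(** Exhaustion by the cubes [-k, k)^n. The one with k = 0 has side 0, so the volume formula is
    assumed for nonnegative sides. *)
Lemma lebRn_sigma_finite n : (forall Q : @cube R n, 0 <= side Q ->
    @lebRn R n (cubeset Q) = (side Q ^+ n)%:E) ->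
  sigma_finite setT (@lebRn R n).
Proof.
move=> H; exists (fun k => cubeset ([tuple - k%:R | i < n], k%:R *+ 2)).
  apply/seteqP; split=> // x _.
  pose M := \sum_(i < n) `|tnth x i|.
  have [k Hk] : exists k, M < k%:R.
    by exists (Num.Def.truncn M).+1; exact: truncnS_gt.
  exists k => // i; rewrite tnth_mktuple /side /=.
  have : `|tnth x i| < k%:R.
    apply: le_lt_trans Hk; rewrite /M (bigD1 i)//= lerDl.
    by apply: sumr_ge0.
  by rewrite ltr_norml => /andP[]; rewrite mulr2n addrA addNr add0r => /ltW.
move=> k; split; first exact: measurable_cubeset.
by rewrite H ?ltry// /side /= mulrn_wge0.
Qed.

(** Both claims go through one induction: the product with the n-dimensional measure needs that
    measure to be sigma-finite, and sigma-finiteness comes from the finite volume of cubes. *)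
Lemma lebRn_exists n : (exists mu : {sigma_finite_measure set (n.-tuple R) -> \bar R},
   (mu : set _ -> \bar R) = @lebRn R n) /\
  (forall Q : @cube R n, 0 <= side Q -> @lebRn R n (cubeset Q) = (side Q ^+ n)%:E).
Proof.
have mk m (mu : {measure set (m.-tuple R) -> \bar R}) :
    (mu : set _ -> \bar R) = @lebRn R m -> sigma_finite setT (@lebRn R m) ->
    exists nu : {sigma_finite_measure set (m.-tuple R) -> \bar R},
      (nu : set _ -> \bar R) = @lebRn R m.
  move=> muE sf; rewrite -muE in sf.
  by exists (as_sigma_finite sf).
elim: n => [|n [[mu muE] IH]].
  have H0 (Q : @cube R 0) : 0 <= side Q -> @lebRn R 0 (cubeset Q) = (side Q ^+ 0)%:E.
    by move=> _ /=; rewrite indicE mem_set// => -[].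
  split=> //; apply: (mk 0 (dirac [tuple])) => //.
  exact: lebRn_sigma_finite.
have HS := lebRn_cubeset_aux muE IH.
split=> //.
apply: (mk n.+1 (pushforward (@lebesgue_measure R \x mu)%E
  (@tuple_cons_pair n) : {measure set _ -> \bar R})).
- exact: measurable_tuple_cons_pair.
- by move=> mc; rewrite (lebRnS muE).
- exact: lebRn_sigma_finite.
Qed.

Let lebRn0 n : @lebRn R n set0 = 0%E.
Proof. by have [[mu <-] _] := lebRn_exists n; exact: measure0. Qed.

Let lebRn_ge0 n A : (0 <= @lebRn R n A)%E.
Proof. by have [[mu <-] _] := lebRn_exists n; exact: measure_ge0. Qed.

Let lebRn_additive n : semi_sigma_additive (@lebRn R n).
Proof.
by have [[mu <-] _] := lebRn_exists n; exact: measure_semi_sigma_additive.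
Qed.

HB.instance Definition _ n := isMeasure.Build _ _ _ (@lebRn R n)
  (@lebRn0 n) (@lebRn_ge0 n) (@lebRn_additive n).

Lemma lebRn_cubeset n (Q : @cube R n) : 0 <= side Q ->
  @lebRn R n (cubeset Q) = (side Q ^+ n)%:E.
Proof. by have [_] := lebRn_exists n; exact. Qed.

End lebRn_measure.

(** * Cubes and coverings *)

Section cubes.
Context {R : realType} {n : nat}.
Implicit Types (P Q : @cube R n) (s : seq (@cube R n)) (D : @cube R n -> @cube R n).

Lemma corner_cubeset P : is_cube P -> cubeset P (corner P).
Proof. by move=> P0 i; rewrite lexx ltrDl. Qed.

Lemma cubeset_subP P Q : is_cube P ->
  cubeset P `<=` cubeset Q <->
  forall i, tnth (corner Q) i <= tnth (corner P) i /\
    tnth (corner P) i + side P <= tnth (corner Q) i + side Q.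
Proof.
move=> P0; split=> [PQ i|H x Px i]; last first.
  have [H1 H2] := H i; have [H3 H4] := Px i.
  by split; [exact: le_trans H3|exact: lt_le_trans H2].
split; first by have [] := PQ _ (corner_cubeset P0) i.
rewrite leNgt; apply/negP => lt.
(* The point that follows is the corner of [P] pushed in direction i up to the upper face of [Q]:
   still in [P] by the assumption [lt], but no longer in [Q]. *)
pose y := Num.max (tnth (corner P) i) (tnth (corner Q) i + side Q).
pose x := [tuple if j == i then y else tnth (corner P) j | j < n].
have Px : cubeset P x.
  move=> j; rewrite tnth_mktuple; case: eqP => [->|_]; last first.
    by have := corner_cubeset P0 j.
  by rewrite /y le_max lexx /= gt_max lt ltrDl P0.
have [_] := PQ _ Px i; rewrite tnth_mktuple eqxx /y.
by rewrite gt_max ltxx andbF.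
Qed.

Lemma is_cube_dilate (c : R) P : 0 < c -> is_cube P -> is_cube (dilate c P).
Proof. by move=> c0 P0; rewrite /is_cube /dilate /side /= mulr_gt0. Qed.

Lemma side_dilate (c : R) P : side (dilate c P) = c * side P.
Proof. by []. Qed.

Lemma tnth_corner_dilate (c : R) P i :
  tnth (corner (dilate c P)) i = tnth (corner P) i - (c - 1) * side P / 2.
Proof. by rewrite tnth_mktuple. Qed.

Lemma dilate_le (c d : R) P : 0 < c -> is_cube P -> c <= d ->
  cubeset (dilate c P) `<=` cubeset (dilate d P).
Proof.
move=> c0 P0 cd; apply/cubeset_subP; first exact: is_cube_dilate.
move=> i; rewrite !tnth_corner_dilate !side_dilate.
have H : c * side P <= d * side P by rewrite ler_pM2r.
by split; lra.
Qed.

Lemma cubeset_dilate (c : R) P : is_cube P -> 1 <= c ->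
  cubeset P `<=` cubeset (dilate c P).
Proof.
move=> P0 c1; apply/cubeset_subP => // i.
rewrite tnth_corner_dilate side_dilate.
have H : 1 * side P <= c * side P by rewrite ler_pM2r.
by split; lra.
Qed.

Lemma dilate2_sub P Q : is_cube P -> cubeset P `<=` cubeset Q ->
  cubeset (dilate 2 P) `<=` cubeset (dilate 2 Q).
Proof.
move=> P0 /(cubeset_subP _ P0) PQ.
apply/cubeset_subP; first exact: is_cube_dilate.
move=> i; have [H1 H2] := PQ i; rewrite !tnth_corner_dilate !side_dilate.
by split; lra.
Qed.

Lemma cubeset_dilate3 P Q : is_cube P -> side P <= side Q ->
  cubeset P `&` cubeset Q !=set0 -> cubeset P `<=` cubeset (dilate 3 Q).
Proof.
move=> P0 PQ [x [Px Qx]]; apply/cubeset_subP => // i.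
have [H1 H2] := Px i; have [H3 H4] := Qx i.
by rewrite tnth_corner_dilate side_dilate; split; lra.
Qed.

Lemma exists_max_seq (T : eqType) (f : T -> R) (s : seq T) : s != [::] ->
  exists2 x, x \in s & forall y, y \in s -> f y <= f x.
Proof.
elim: s => [//|x s IH] _; have [->|/IH[y ys Hy]] := eqVneq s [::].
  by exists x; [rewrite mem_head|move=> y; rewrite inE => /eqP ->].
have [xy|yx] := leP (f x) (f y).
  exists y; first by rewrite inE ys orbT.
  by move=> z; rewrite inE => /orP[/eqP ->//|/Hy].
exists x; first by rewrite mem_head.
move=> z; rewrite inE => /orP[/eqP ->//|/Hy zy].
exact: le_trans (ltW yx).
Qed.

(** Greedy selection: keep a cube of largest side, discard those that meet it, which lie in its
    triple, and recurse on the rest. Finiteness of the list provides a largest cube, hence the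
    factor 3. The map [D] is there because the selection is made among the doubles of the listed
    cubes. *)
Lemma vitali_cubes D s : (forall P, P \in s -> is_cube (D P)) ->
  exists s', [/\ uniq s', {subset s' <= s},
    trivIset [set` s'] (fun P => cubeset (D P)) &
    forall P, P \in s -> exists2 P', P' \in s' &
      cubeset (D P) `<=` cubeset (dilate 3 (D P'))].
Proof.
have [k] := ubnP (size s); elim: k s => // k IH s sk sD.
have [->|/(exists_max_seq (fun P => side (D P)))[P0 P0s P0max]] := eqVneq s [::].
  by exists [::]; split.
pose s1 := [seq P <- s | `[< cubeset (D P) `&` cubeset (D P0) = set0 >]].
have ss1 : {subset s1 <= s} by move=> P; rewrite mem_filter => /andP[].
have D0 P : P \in s -> cubeset (D P) `&` cubeset (D P) != set0.
  by move=> /sD /corner_cubeset Pc; apply/set0P; exists (corner (D P)).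
(* A nonempty cube meets itself, so [P0] is discarded and the remaining list is strictly shorter. *)
have P0s1 : P0 \notin s1.
  rewrite mem_filter negb_and; apply/orP; left; apply/negP => /asboolP.
  by apply/eqP/D0.
have [|P /ss1/sD//|s' [us' ss' ts' cs']] := IH s1.
  apply: leq_trans (_ : size s <= k)%N; last by rewrite -ltnS.
  rewrite ltnNge; apply/negP => le.
  have /all_filterP E : all (fun P => `[< cubeset (D P) `&` cubeset (D P0) = set0 >]) s.
    by rewrite all_count eqn_leq count_size /= -size_filter.
  by move: P0s1; rewrite /s1 E P0s.
have dj P : P \in s' -> cubeset (D P) `&` cubeset (D P0) = set0.
  by move=> /ss'; rewrite mem_filter => /andP[/asboolP].
exists (P0 :: s'); split.
- by rewrite /= us' andbT; apply: contra P0s1 => /ss'.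
- by move=> P; rewrite inE => /orP[/eqP ->//|/ss'/ss1].
- move=> P P' /=; rewrite !inE => /orP[/eqP->|Ps] /orP[/eqP->//|P's].
  + by rewrite setIC dj// => -[].
  + by rewrite dj// => -[].
  + exact: ts'.
- move=> P Ps; have [H|H] := pselect (cubeset (D P) `&` cubeset (D P0) = set0).
    have [|P' P's PP'] := cs' P; first by rewrite mem_filter Ps andbT; apply/asboolP.
    by exists P' => //; rewrite inE P's orbT.
  exists P0; first by rewrite mem_head.
  apply: cubeset_dilate3; [exact: sD|exact: P0max|].
  by apply/set0P/eqP.
Qed.

Local Notation leb := (@lebRn R n).

Lemma sum_integral_le D s (X : set (n.-tuple R)) (w : n.-tuple R -> \bar R) :
  measurable X -> measurable_fun [set: n.-tuple R] w -> (forall x, (0 <= w x)%E) ->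
  uniq s -> trivIset [set` s] (fun P => cubeset (D P)) ->
  (forall P, P \in s -> cubeset (D P) `<=` X) ->
  (\sum_(P <- s) \int[leb]_(x in cubeset (D P)) w x <= \int[leb]_(x in X) w x)%E.
Proof.
move=> mX mw w0 us ts sX.
rewrite -(ge0_integral_bigsetU _ _ us ts) //; last 2 first.
- by move=> P; exact: measurable_cubeset.
- exact: measurable_funTS.
apply: ge0_subset_integral => //.
- by apply: bigsetU_measurable => P _; exact: measurable_cubeset.
- exact: measurable_funTS.
- by rewrite -bigcup_seq => x [P /= /sX]; exact.
Qed.

Lemma integral_cst1 (A : set (n.-tuple R)) : measurable A ->
  (\int[leb]_(x in A) (cst 1%E) x = leb A)%E.
Proof. by move=> mA; rewrite integral_cst// mul1e. Qed.

Lemma sum_vol_le D s Q :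
  (forall P, P \in s -> is_cube (D P)) -> is_cube Q ->
  uniq s -> trivIset [set` s] (fun P => cubeset (D P)) ->
  (forall P, P \in s -> cubeset (D P) `<=` cubeset Q) ->
  \sum_(P <- s) side (D P) ^+ n <= side Q ^+ n.
Proof.
move=> sD Q0 us ts sX.
rewrite -lee_fin -(lebRn_cubeset (ltW Q0)) -integral_cst1; last exact: measurable_cubeset.
have := sum_integral_le (measurable_cubeset Q) (measurable_cst 1%E) (fun=> lee01) us ts sX.
apply: le_trans; rewrite -sumEFin big_seq [leRHS]big_seq; apply: lee_sum => P Ps.
rewrite integral_cst1; last exact: measurable_cubeset.
by rewrite lebRn_cubeset//; exact: ltW (sD _ Ps).
Qed.

(** Double counting of the pairs with [E P] inside [D P']: every [P] occurs in at least one pair,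
    and the disjoint cubes inside a fixed [D P'] total at most its volume. The covering cubes may
    overlap. *)
Lemma sum_vol_cover (E D : @cube R n -> @cube R n) s s' :
  (forall P, P \in s -> is_cube (E P)) ->
  (forall P, P \in s' -> is_cube (D P)) ->
  uniq s -> trivIset [set` s] (fun P => cubeset (E P)) ->
  (forall P, P \in s -> exists2 P', P' \in s' & cubeset (E P) `<=` cubeset (D P')) ->
  \sum_(P <- s) side (E P) ^+ n <= \sum_(P <- s') side (D P) ^+ n.
Proof.
move=> sE sD us ts cov.
pose c P P' := `[< cubeset (E P) `<=` cubeset (D P') >].
have vE P : P \in s -> 0 <= side (E P) ^+ n by move=> /sE/ltW ?; rewrite exprn_ge0.
apply: (@le_trans _ _ (\sum_(P <- s) \sum_(P' <- s' | c P P') side (E P) ^+ n)).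
  rewrite big_seq [leRHS]big_seq; apply: ler_sum => P Ps.
  have [P' P's PP'] := cov P Ps.
  rewrite big_mkcond (big_rem P')//= /c asboolT//= lerDl.
  by apply: sumr_ge0 => i _; case: ifP => // _; exact: vE.
rewrite (exchange_big_dep predT)//= big_seq [leRHS]big_seq.
apply: ler_sum => P' P's.
rewrite -big_filter; apply: sum_vol_le => //.
- by move=> P; rewrite mem_filter => /andP[_ /sE].
- exact: sD.
- exact: filter_uniq.
- by apply: sub_trivIset ts => P /=; rewrite mem_filter => /andP[].
- by move=> P; rewrite mem_filter => /andP[/asboolP].
Qed.

End cubes.

(** * Dyadic subcubes *)

Section dyadic.
Context {R : realType} {n : nat}.
Implicit Types (P Q : @cube R n) (bad : pred (@cube R n)) (e : {ffun 'I_n -> bool}).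

Definition child P e : @cube R n :=
  ([tuple tnth (corner P) i + (e i)%:R * (side P / 2) | i < n], side P / 2).

Definition children P : seq (@cube R n) :=
  [seq child P e | e <- enum {ffun 'I_n -> bool}].

Lemma childrenP P C : reflect (exists e, C = child P e) (C \in children P).
Proof.
apply: (iffP mapP) => [[e _ ->]|[e ->]]; first by exists e.
by exists e => //; rewrite mem_enum.
Qed.

Lemma side_child P e : side (child P e) = side P / 2. Proof. by []. Qed.

Lemma is_cube_child P e : is_cube P -> is_cube (child P e).
Proof. by move=> P0; rewrite /is_cube side_child divr_gt0. Qed.

Lemma child_sub P e : is_cube P -> cubeset (child P e) `<=` cubeset P.
Proof.
move=> P0; apply/cubeset_subP; first exact: is_cube_child.
move=> i; rewrite tnth_mktuple side_child; have : 0 < side P by [].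
by case: (e i) => /= ?; split; lra.
Qed.

Lemma child_cover P x : cubeset P x -> exists e, cubeset (child P e) x.
Proof.
move=> Px; exists [ffun i => tnth (corner P) i + side P / 2 <= tnth x i] => i.
have [H1 H2] := Px i; rewrite tnth_mktuple ffunE side_child.
by case: (lerP (tnth (corner P) i + side P / 2)) => /= ?; split; lra.
Qed.

Lemma child_inj P e e' x :
  cubeset (child P e) x -> cubeset (child P e') x -> e = e'.
Proof.
move=> H H'; apply/ffunP => i.
have := H i; have := H' i; rewrite !tnth_mktuple !side_child.
by case: (e i) (e' i) => -[] //= [? ?] [? ?]; exfalso; lra.
Qed.

Lemma children_triv P C C' x : C \in children P -> C' \in children P ->
  cubeset C x -> cubeset C' x -> C = C'.
Proof.
by move=> /childrenP[e ->] /childrenP[e' ->] H H'; rewrite (child_inj H H').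
Qed.

Lemma children_sub P C : is_cube P -> C \in children P ->
  is_cube C /\ cubeset C `<=` cubeset P.
Proof.
move=> P0 /childrenP[e ->]; split; [exact: is_cube_child|exact: child_sub].
Qed.

Fixpoint gen m P : seq (@cube R n) :=
  if m is m'.+1 then flatten [seq gen m' C | C <- children P] else [:: P].

(* The maximal [bad] dyadic subcubes of [P] within the first [m] generations. *)
Fixpoint stop bad m P : seq (@cube R n) :=
  if bad P then [:: P] else
  if m is m'.+1 then flatten [seq stop bad m' C | C <- children P] else [::].

Lemma genSP m P Q :
  reflect (exists2 C, C \in children P & Q \in gen m C) (Q \in gen m.+1 P).
Proof. exact: flatten_mapP. Qed.

Lemma stopP bad m P Q : Q \in stop bad m P ->
  (bad P /\ Q = P) \/ (~~ bad P /\
    exists m' C, [/\ m = m'.+1, C \in children P & Q \in stop bad m' C]).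
Proof.
case: m => [|m] /=; case: (boolP (bad P)) => bP.
- by rewrite inE => /eqP ->; left.
- by rewrite in_nil.
- by rewrite inE => /eqP ->; left.
- by move=> /flatten_mapP[C Cc QC]; right; split=> //; exists m, C.
Qed.

Lemma stop_child bad m P C Q : ~~ bad P -> C \in children P ->
  Q \in stop bad m C -> Q \in stop bad m.+1 P.
Proof. by move=> /negbTE /= -> CP QC; apply/flatten_mapP; exists C. Qed.

Lemma stop_root bad m P : bad P -> stop bad m P = [:: P].
Proof. by case: m => [|m] /= ->. Qed.

Lemma gen_sub m P Q : is_cube P -> Q \in gen m P ->
  [/\ is_cube Q, cubeset Q `<=` cubeset P & side Q = side P / 2 ^+ m].
Proof.
elim: m P => [|m IH] P P0.
  by rewrite inE => /eqP ->; split=> //; rewrite expr0 divr1.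
move=> /genSP[C CP QC]; have [C0 CsP] := children_sub P0 CP.
have [Q0 QsC sQ] := IH _ C0 QC; split=> //; first exact: subset_trans CsP.
move/childrenP: CP sQ => [e ->]; rewrite side_child => ->.
by rewrite exprS invfM mulrA.
Qed.

Lemma gen_cover m P x : cubeset P x -> exists2 Q, Q \in gen m P & cubeset Q x.
Proof.
elim: m P => [|m IH] P Px; first by exists P; rewrite ?inE.
have [e /IH[Q Qe Qx]] := child_cover Px; exists Q => //.
by apply/genSP; exists (child P e) => //; apply/childrenP; exists e.
Qed.

Lemma gen_triv m P : is_cube P -> trivIset [set` gen m P] (fun Q => cubeset Q).
Proof.
elim: m P => [|m IH] P P0 Q Q' /=; first by rewrite !inE => /eqP -> /eqP ->.
move=> /genSP[C CP QC] /genSP[C' CP' QC'] [x [Qx Qx']].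
have [C0 _] := children_sub P0 CP; have [C'0 _] := children_sub P0 CP'.
have [_ QsC _] := gen_sub C0 QC; have [_ QsC' _] := gen_sub C'0 QC'.
have CC' := children_triv CP CP' (QsC _ Qx) (QsC' _ Qx').
by apply: (IH C) => //=; [rewrite CC'|exists x].
Qed.

Lemma gen_refine m m' P Q : is_cube P -> (m <= m')%N -> Q \in gen m' P ->
  exists2 Q', Q' \in gen m P & cubeset Q `<=` cubeset Q'.
Proof.
elim: m m' P => [|m IH] m' P P0.
  by move=> _ /(gen_sub P0)[_ H _]; exists P; rewrite ?inE.
case: m' => // m' mm' /genSP[C CP QC].
have [C0 _] := children_sub P0 CP; have [Q' Q'C QQ'] := IH _ _ C0 mm' QC.
by exists Q' => //; apply/genSP; exists C.
Qed.

Lemma stop_sub bad m P Q : is_cube P -> Q \in stop bad m P ->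
  [/\ bad Q, is_cube Q & cubeset Q `<=` cubeset P].
Proof.
elim: m P => [|m IH] P P0 /stopP[[bP ->]|[_ [? [C [// [<-] CP QC]]]]];
  try by split.
have [C0 CsP] := children_sub P0 CP; have [bQ Q0 QsC] := IH _ C0 QC.
by split=> //; exact: subset_trans CsP.
Qed.

Lemma stop_triv bad m P : is_cube P ->
  trivIset [set` stop bad m P] (fun Q => cubeset Q).
Proof.
elim: m P => [|m IH] P P0 Q Q' /=.
  by case: ifP => // _; rewrite !inE => /eqP -> /eqP ->.
case: ifP => [_|bP]; first by rewrite !inE => /eqP -> /eqP ->.
move=> /flatten_mapP[C CP QC] /flatten_mapP[C' CP' QC'] [x [Qx Qx']].
have [C0 _] := children_sub P0 CP; have [C'0 _] := children_sub P0 CP'.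
have [_ _ QsC] := stop_sub C0 QC; have [_ _ QsC'] := stop_sub C'0 QC'.
have CC' := children_triv CP CP' (QsC _ Qx) (QsC' _ Qx').
by apply: (IH C) => //=; [rewrite CC'|exists x].
Qed.

(** Along each branch a weaker predicate stops no later. With [bad'] at level L t and [bad] at level
    t this nests the two stopping families. *)
Lemma stop_mono bad bad' m P Q : is_cube P -> (forall Q', is_cube Q' -> bad' Q' -> bad Q') ->
  Q \in stop bad' m P ->
  exists2 Q', Q' \in stop bad m P & cubeset Q `<=` cubeset Q'.
Proof.
move=> + bb; elim: m P => [|m IH] P P0 /[dup] /(stop_sub P0)[_ _ QP];
  have [bP _|bP] := boolP (bad P);
  try (by exists P; rewrite ?stop_root ?inE).
  by move=> /stopP[[/(bb _ P0)]|[_ [? [? []]]]]; rewrite ?(negbTE bP).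
move=> /stopP[[/(bb _ P0)]|[_ [? [C [[<-] CP QC]]]]]; first by rewrite (negbTE bP).
have [C0 CsP] := children_sub P0 CP; have [Q' QC' QQ'] := IH _ C0 QC.
by exists Q' => //; exact: stop_child CP QC'.
Qed.

(** Maximality: the descent went past the parent, so the parent is not bad. A bad root would be
    stopped itself and have no parent. *)
Lemma stop_parent bad m P Q : is_cube P -> ~~ bad P -> Q \in stop bad m P ->
  exists P', [/\ is_cube P', cubeset Q `<=` cubeset P',
    cubeset P' `<=` cubeset P, ~~ bad P' & side P' = 2 * side Q].
Proof.
elim: m P => [|m IH] P P0 bP.
  by move=> /stopP[[bP']|[_ [? [? []]]]//]; rewrite bP' in bP.
move=> /stopP[[bP']|[_ [? [C [[<-] CP QC]]]]]; first by rewrite bP' in bP.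
have [C0 CsP] := children_sub P0 CP.
have [bC|bC] := boolP (bad C).
  move: QC; rewrite stop_root// inE => /eqP ->; exists P; split=> //.
  by move/childrenP : CP => [e ->]; rewrite side_child; field.
have [P' [P'0 QP' P'C bP' sP']] := IH _ C0 bC QC.
by exists P'; split=> //; exact: subset_trans CsP.
Qed.

(** The first bad cube on the path from [P] down to [Q] is a stopping cube. *)
Lemma gen_stop bad m P Q : is_cube P -> Q \in gen m P -> bad Q ->
  exists2 Q', Q' \in stop bad m P & cubeset Q `<=` cubeset Q'.
Proof.
elim: m P => [|m IH] P P0.
  by rewrite inE => /eqP -> bP; exists P => //=; rewrite bP inE.
move=> /[dup] /(gen_sub P0)[_ QP _] /genSP[C CP QC] bQ.
have [bP|bP] := boolP (bad P); first by exists P; rewrite ?stop_root ?inE.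
have [C0 CsP] := children_sub P0 CP; have [Q' QC' QQ'] := IH _ C0 QC bQ.
by exists Q' => //; exact: stop_child CP QC'.
Qed.

End dyadic.

(** * Approximation by dyadic sets *)

Section dyadic_approximation.
Context {R : realType} {n : nat}.
Variable Q : @cube R n.
Hypothesis Q0 : is_cube Q.
Local Notation leb := (@lebRn R n).
Implicit Types F D : set (n.-tuple R).

(** Inside [Q] this is a union of cubes of generation m, phrased as no such cube being cut, which
    makes complements and unions immediate; outside [Q] the set is arbitrary. *)
Definition dyadic_set m D := measurable D /\
  forall P, P \in gen m Q -> cubeset P `<=` D \/ cubeset P `&` D = set0.

Definition approximable F := measurable F /\
  forall d : R, 0 < d -> exists m D,
    dyadic_set m D /\ (leb (cubeset Q `&` (F `+` D)) < d%:E)%E.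

Lemma dyadic_set_le m m' D : (m <= m')%N -> dyadic_set m D -> dyadic_set m' D.
Proof.
move=> mm' [mD H]; split=> // P Pm'.
have [P' /H P'D PP'] := gen_refine Q0 mm' Pm'.
case: P'D => [P'D|P'D]; [left|right]; first exact: subset_trans P'D.
by apply/seteqP; split=> // x [/PP' P'x Dx]; rewrite -P'D.
Qed.

Lemma dyadic_setU m D D' : dyadic_set m D -> dyadic_set m D' ->
  dyadic_set m (D `|` D').
Proof.
move=> [mD H] [mD' H']; split; first exact: measurableU.
move=> P Pm; case: (H _ Pm) => [PD|PD]; first by left=> x /PD; left.
case: (H' _ Pm) => [PD'|PD']; first by left=> x /PD'; right.
by right; rewrite setIUr PD PD' setU0.
Qed.

Lemma dyadic_setC m D : dyadic_set m D -> dyadic_set m (~` D).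
Proof.
move=> [mD H]; split; first exact: measurableC.
move=> P Pm; case: (H _ Pm) => [PD|PD]; [right|left].
  by apply/seteqP; split=> // x [/PD].
by move=> x Px Dx; have : (cubeset P `&` D) x by []; rewrite PD.
Qed.

Lemma measurable_setY F D : measurable F -> measurable D ->
  measurable (cubeset Q `&` (F `+` D)).
Proof.
move=> mF mD; apply: measurableI; first exact: measurable_cubeset.
by apply: measurableU; exact: measurableD.
Qed.

Lemma dyadic_approximable m D : dyadic_set m D -> approximable D.
Proof.
move=> DD; split; first by case: DD.
move=> d d0; exists m, D; split=> //; rewrite setYK setI0 measure0.
by rewrite lte_fin.
Qed.

Lemma approximableU F F' : approximable F -> approximable F' ->
  approximable (F `|` F').
Proof.
move=> [mF H] [mF' H']; split; first exact: measurableU.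
move=> d d0; have d20 : 0 < d / 2 by lra.
have [m [D [DD HD]]] := H _ d20; have [m' [D' [DD' HD']]] := H' _ d20.
exists (maxn m m'), (D `|` D'); split.
  by apply: dyadic_setU; [apply: dyadic_set_le DD|apply: dyadic_set_le DD'];
    rewrite ?leq_maxl ?leq_maxr.
have [mD _] := DD; have [mD' _] := DD'.
rewrite [d]splitr EFinD; apply: le_lt_trans (lteD HD HD').
apply: (le_trans _ (measureU2 _ _ _)) => /=; try exact: measurable_setY.
apply: le_measure; rewrite ?inE; try apply: measurable_setY; try exact: measurableU.
  by apply: measurableU; exact: measurable_setY.
move=> x [Qx [[[Fx|Fx] Dx]|[[Dx|Dx] Fx]]].
- by left; split=> //; left; split=> // ?; apply: Dx; left.
- by right; split=> //; left; split=> // ?; apply: Dx; right.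
- by left; split=> //; right; split=> // ?; apply: Fx; left.
- by right; split=> //; right; split=> // ?; apply: Fx; right.
Qed.

(** Continuity from above on [Q], which has finite measure: the part of the union missed by the
    partial union [G k] tends to measure 0. Half of the tolerance pays for that part, half for
    approximating [G k]. *)
Lemma approximable_bigcup (F : nat -> set (n.-tuple R)) :
  (forall k, approximable (F k)) -> approximable (\bigcup_k F k).
Proof.
move=> aF; have mF k : measurable (F k) by case: (aF k).
pose G k := \big[setU/set0]_(i < k) F i.
have aG k : approximable (G k).
  rewrite /G; elim: k => [|k IH]; last by rewrite big_ord_recr; exact: approximableU.
  rewrite big_ord0; apply: (@dyadic_approximable 0); split=> // P _; right.
  by rewrite setI0.
have mU : measurable (\bigcup_k F k) by apply: bigcup_measurable => k _.
split=> // d d0; have d20 : 0 < d / 2 by lra.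
pose E k := cubeset Q `&` (\bigcup_k F k `\` G k).
have mE k : measurable (E k).
  apply: measurableI; first exact: measurable_cubeset.
  by apply: measurableD => //; case: (aG k).
have E0 : \bigcap_k E k = set0.
  apply/seteqP; split=> // x H; have [_ [[k _ Fk] _]] := H 0%N I.
  have [_ [_ ]] := H k.+1 I; apply; rewrite /G -bigcup_mkord.
  by exists k => //=.
have cE : leb (E k) @[k --> \oo] --> 0%E.
  rewrite -(@measure0 _ _ _ leb) -E0; apply: nonincreasing_cvg_mu => //.
  - apply: (@le_lt_trans _ _ (leb (cubeset Q))); last first.
      by rewrite lebRn_cubeset ?ltry// ltW.
    apply: le_measure; rewrite ?inE//; first exact: measurable_cubeset.
    exact: subIsetl.
  - by rewrite E0.
  - move=> i j ij; apply/subsetPset => x [Qx [Ux Gx]]; split=> //; split=> // Gi.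
    by apply: Gx; move: Gi; rewrite /G -!bigcup_mkord => -[k /= ki Fk];
      exists k => //=; exact: leq_trans ij.
have /cE[k _ /(_ k (leqnn k)) Ek] : nbhs (0%E : \bar R) [set y | (y < (d / 2)%:E)%E].
  by apply: open_nbhs_nbhs; split; [exact: open_ereal_lt_ereal|rewrite /= lte_fin].
have [mG /(_ _ d20)[m [D [DD HD]]]] := aG k; have [mD _] := DD.
exists m, D; split=> //.
rewrite [d]splitr EFinD; apply: le_lt_trans (lteD Ek HD).
apply: (le_trans _ (measureU2 _ _ _)) => //=; last exact: measurable_setY.
apply: le_measure; rewrite ?inE; first exact: measurable_setY.
  by apply: measurableU => //; exact: measurable_setY.
move=> x [Qx [[Ux Dx]|[Dx Ux]]].
  have [Gx|Gx] := pselect (G k x); last by left; split.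
  by right; split=> //; left.
right; split=> //; right; split=> // Gx; apply: Ux.
by move: Gx; rewrite /G -bigcup_mkord => -[i _ Fi]; exists i.
Qed.

Lemma approximable_sigma_algebra : sigma_algebra setT approximable.
Proof.
split.
- by apply: (@dyadic_approximable 0); split=> // P _; right; rewrite setI0.
- move=> F [mF H]; rewrite setTD; split; first exact: measurableC.
  move=> d /H[m [D [DD HD]]]; exists m, (~` D); split; first exact: dyadic_setC.
  congr (leb _ < _)%E: HD; congr (_ `&` _).
  apply/seteqP; split=> x [[H1 H2]|[H1 H2]].
  + by right; split=> // /(_ H1).
  + by left; split=> // /(_ H1).
  + by right; split=> //; apply: contrapT.
  + by left; split=> //; apply: contrapT.
- exact: approximable_bigcup.
Qed.

(** The approximation only sees the trace on [Q]. This serves half-spaces, whose description by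
    dyadic cubes holds only inside [Q]. *)
Lemma approximable_ext F F' : measurable F' ->
  cubeset Q `&` F = cubeset Q `&` F' -> approximable F -> approximable F'.
Proof.
move=> mF' FF' [mF H]; split=> // d /H[m [D [DD HD]]]; exists m, D; split=> //.
congr (leb _ < _)%E: HD; rewrite /setY !setIUr !setIDA FF'; congr (_ `|` _).
have E A : cubeset Q `&` D `\` A = cubeset Q `&` D `\` (cubeset Q `&` A).
  apply/seteqP; split=> x [[Qx Dx] H']; split=> //; first by case.
  by move=> Ax; apply: H'.
by rewrite E [RHS]E FF'.
Qed.

(** The open half-space, within [Q], is the union over m of the generation m cubes contained in it:
    a point belongs to such a cube as soon as the side is below its distance to the boundary. *)
Lemma approximable_halfspace i (c : R) :
  approximable ((fun x : n.-tuple R => tnth x i) @^-1` `]c, +oo[%classic).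
Proof.
set H := (X in approximable X).
have mH : measurable H.
  by rewrite -[X in measurable X]setTI; apply: measurable_tnth.
pose D m := \big[setU/set0]_(P <- [seq P <- gen m Q | `[< cubeset P `<=` H >]]) cubeset P.
have DP m x : D m x <-> exists P, [/\ P \in gen m Q, cubeset P `<=` H & cubeset P x].
  rewrite /D -bigcup_seq; split=> [[P /=]|[P [P1 P2 P3]]].
    by rewrite mem_filter => /andP[/asboolP P1 P2] P3; exists P.
  by exists P => //=; rewrite mem_filter P1 andbT; apply/asboolP.
have aD m : approximable (D m).
  apply: (@dyadic_approximable m); split.
    by apply: bigsetU_measurable => P _; exact: measurable_cubeset.
  move=> P Pm; have [PH|PH] := pselect (cubeset P `<=` H).
    by left=> x Px; apply/DP; exists P.
  right; apply/seteqP; split=> // x [Px /DP[P' [P'm P'H P'x]]].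
  by apply: PH; rewrite (gen_triv Q0 Pm P'm)//; exists x.
apply: (@approximable_ext (\bigcup_m D m)) => //; last exact: approximable_bigcup.
apply/seteqP; split=> x [Qx]; first by move=> [m _ /DP[P [_ PH Px]]]; split=> //; exact: PH.
move=> Hx; split=> //.
have Hxc : c < tnth x i by move: Hx; rewrite /H /= in_itv /= andbT.
(* The Archimedean bound m of y satisfies y < 2^m, so that side Q / 2^m falls below the distance. *)
pose m := Num.Def.archi_bound (side Q / (tnth x i - c)).
have [P Pm Px] := gen_cover m Qx; exists m => //; apply/DP; exists P; split=> //.
have [P0 _ sP] := gen_sub Q0 Pm => y Py.
rewrite /H /= in_itv /= andbT.
have : side P < tnth x i - c.
  rewrite sP ltr_pdivrMr ?exprn_gt0// mulrC -ltr_pdivrMr ?subr_gt0//.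
  exact: upper_nthrootP.
have [? ?] := Px i; have [? ?] := Py i; lra.
Qed.

(** The sigma-algebra on tuples is generated by coordinate preimages of Borel sets, and these by
    open rays, so half-spaces suffice. *)
Lemma measurable_approximable F : measurable F -> approximable F.
Proof.
apply: smallest_sub; first exact: approximable_sigma_algebra.
rewrite -bigcup_seq => _ [i _ [B mB <-]].
have {mB} : (RGenOInfty.G (R:=R)).-sigma.-measurable B by rewrite -RGenOInfty.measurableE.
have sI := sigma_algebra_image (fun x : n.-tuple R => tnth x i) approximable_sigma_algebra.
apply: (smallest_sub sI) => _ [c ->] /=.
by rewrite /image_set_system /= setTI; exact: approximable_halfspace.
Qed.

End dyadic_approximation.

(** * Powers and integrals *)

Section preliminaries.
Context {R : realType}.

Lemma powR_ler (p x y : R) : 0 <= p -> 0 <= x -> x <= y -> x `^ p <= y `^ p.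
Proof.
by move=> p0 x0 xy; apply: ge0_ler_powR; rewrite ?nnegrE//; exact: le_trans xy.
Qed.

Lemma powR_ler_inv (p x y : R) : 0 < p -> 0 <= x -> 0 <= y ->
  x `^ p <= y `^ p -> x <= y.
Proof.
move=> p0 x0 y0 xy; have := powR_ler (ltW (_ : 0 < p^-1)) (powR_ge0 _ _) xy.
by rewrite invr_gt0 -!powRrM mulfV ?gt_eqF// !powRr1//; exact.
Qed.

(** Truncation of [y] at height [s]: below [s] its p-th power is at most s^p, above [s] it is at
    most s^(p - r) y^r. An L^r bound on [v] thus becomes usable at exponent p, with a constant error
    governed by [s]. *)
Lemma powR_split (p r s x y z : R) : 0 < p -> p < r -> 0 < s ->
  0 <= x -> 0 <= y -> 0 <= z -> z <= x + y ->
  z `^ p <= 2 `^ p * (x `^ p + s `^ p + s `^ (p - r) * y `^ r).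
Proof.
move=> p0 pr s0 x0 y0 z0 zxy.
have Hy : y `^ p <= s `^ p + s `^ (p - r) * y `^ r.
  have [ys|sy] := leP y s.
    apply: (@le_trans _ _ (s `^ p)); first by apply: powR_ler => //; exact: ltW.
    by rewrite lerDl mulr_ge0// powR_ge0.
  have yp : 0 < y by exact: lt_trans sy.
  apply: (@le_trans _ _ (s `^ (p - r) * y `^ r)); last by rewrite lerDr powR_ge0.
  rewrite -opprB powRN [y `^ p](_ : _ = (y `^ (r - p))^-1 * y `^ r); last first.
    by rewrite -powRN -powRD ?gt_eqF ?implybT// opprB subrK.
  rewrite ler_pM2r ?powR_gt0// lef_pV2 ?posrE ?powR_gt0//.
  by apply: powR_ler; [rewrite subr_ge0 ltW|exact: ltW|exact: ltW].
have p2 : 0 <= 2 `^ p :> R by exact: powR_ge0.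
have [xy|yx] := leP x y.
  apply: (@le_trans _ _ ((2 * y) `^ p)); first by apply: powR_ler => //; [exact: ltW|lra].
  rewrite powRM//; apply: ler_wpM2l => //; apply: (le_trans Hy).
  by rewrite -addrA lerDr powR_ge0.
apply: (@le_trans _ _ ((2 * x) `^ p)); first by apply: powR_ler => //; [exact: ltW|lra].
rewrite powRM//; apply: ler_wpM2l => //.
by rewrite -addrA lerDl addr_ge0 ?mulr_ge0// powR_ge0.
Qed.

Context {n : nat}.
Local Notation leb := (@lebRn R n).

Lemma measurable_norm_powR (p : R) (g : n.-tuple R -> R) (A : set (n.-tuple R)) :
  measurable_fun setT g -> measurable_fun A (fun x => (`|g x| `^ p)%:E).
Proof.
move=> mg; apply: measurable_funTS; apply/measurable_EFinP.
apply: (measurableT_comp (measurable_powR p)).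
exact: measurableT_comp.
Qed.

Lemma ae_on_le_integral (E : set (n.-tuple R)) (f g : n.-tuple R -> \bar R) :
  measurable E -> measurable_fun E f -> measurable_fun E g ->
  (forall x, E x -> (0 <= f x)%E) -> (forall x, E x -> (0 <= g x)%E) ->
  ae_on E (fun x => (f x <= g x)%E) ->
  (\int[leb]_(x in E) f x <= \int[leb]_(x in E) g x)%E.
Proof.
move=> mE mf mg f0 g0 [N [mN [N0 H]]]; apply: ae_ge0_le_integral => //.
exists N; split=> // x /= /not_implyP[Ex nle]; apply: contrapT => Nx.
by apply: nle; exact: H.
Qed.

Lemma ae_onS (E F : set (n.-tuple R)) (P : n.-tuple R -> Prop) :
  E `<=` F -> ae_on F P -> ae_on E P.
Proof. by move=> EF [N [mN [N0 H]]]; exists N; do 2!split=> //; move=> x /EF; exact: H. Qed.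

Lemma ae_on_imply (E : set (n.-tuple R)) (P P' : n.-tuple R -> Prop) :
  (forall x, E x -> P x -> P' x) -> ae_on E P -> ae_on E P'.
Proof.
move=> PP' [N [mN [N0 H]]]; exists N; do 2!split=> //; move=> x Ex Nx.
exact: PP' (H _ Ex Nx).
Qed.

Lemma ae_onI (E : set (n.-tuple R)) (P P' : n.-tuple R -> Prop) :
  ae_on E P -> ae_on E P' -> ae_on E (fun x => P x /\ P' x).
Proof.
move=> [N [mN [N0 H]]] [N' [mN' [N'0 H']]]; exists (N `|` N').
split; first exact: measurableU.
split; first by change (leb (N `|` N') = 0%E); rewrite measureU0.
move=> x Ex Nx; split; [apply: H|apply: H'] => // ?; apply: Nx; by [left|right].
Qed.

Lemma ge0_integralS (w : n.-tuple R -> \bar R) (E F : set (n.-tuple R)) :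
  measurable E -> measurable F -> measurable_fun setT w ->
  (forall x, (0 <= w x)%E) -> E `<=` F ->
  (\int[leb]_(x in E) w x <= \int[leb]_(x in F) w x)%E.
Proof.
move=> mE mF mw w0 EF; apply: ge0_subset_integral => //; exact: measurable_funTS.
Qed.

End preliminaries.

(** * The good-lambda inequality *)

Section good_lambda.
Context {R : realType} {n : nat}.
Local Notation leb := (@lebRn R n).
Local Notation vol P := (side P ^+ n).
Local Notation Ip p E g := (\int[leb]_(x in E) (`|g x| `^ p)%:E)%E.
Implicit Types P Q : @cube R n.

Variables (p q r K CD : R) (a : @cube R n -> R) (Q : @cube R n) (g : n.-tuple R -> R).
Hypotheses (p1 : 1 <= p) (pq : p < q) (qr : q < r) (K0 : 0 < K).
Hypotheses (a0 : forall P, is_cube P -> 0 <= a P).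
Hypotheses (Q0 : is_cube Q) (mg : measurable_fun setT g).
Hypothesis gQ : (Ip p (cubeset (dilate 2 Q)) g
  <= (a (dilate 2 Q) `^ p * vol (dilate 2 Q))%:E)%E.
Hypothesis gsplit : forall P, is_cube P -> cubeset P `<=` cubeset Q ->
  exists u v : n.-tuple R -> R, [/\ measurable_fun setT u, measurable_fun setT v,
    ae_on (cubeset (dilate 2 P)) (fun x => g x = u x + v x),
    (Ip p (cubeset (dilate 2 P)) u <= (a (dilate 2 P) `^ p * vol (dilate 2 P))%:E)%E &
    forall t : R, 0 < t ->
      (Ip p (cubeset (dilate 2 P)) g <= (t `^ p * vol (dilate 2 P))%:E)%E ->
      (Ip r (cubeset (dilate 2 P)) v <= ((K * t) `^ r * vol (dilate 2 P))%:E)%E].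
Hypothesis aD : forall s : seq (@cube R n), uniq s ->
  trivIset [set` s] (fun P => cubeset (dilate 2 P)) ->
  (forall P, P \in s -> is_cube P /\ cubeset P `<=` cubeset Q) ->
  \sum_(P <- s) a (dilate 2 P) `^ q * vol (dilate 2 P) <=
    CD * a (dilate 2 Q) `^ q * vol (dilate 2 Q).

Definition bad (t : R) : pred (@cube R n) := fun P =>
  `[< ((t `^ p * vol (dilate 2 P))%:E < Ip p (cubeset (dilate 2 P)) g)%E >].

(** [undup] supplies the uniqueness that list sums over disjoint families require. *)
Definition Stop m t := undup (stop (bad t) m Q).

Definition Nvol m t : R := \sum_(P <- Stop m t) vol P.

Let p0 : 0 < p. Proof. exact: lt_le_trans p1. Qed.
Let pr : p < r. Proof. exact: lt_trans qr. Qed.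

Lemma bad_le (t t' : R) P : 0 < t -> t <= t' -> is_cube P -> bad t' P -> bad t P.
Proof.
move=> t0 tt' P0 /asboolP H; apply/asboolP; apply: le_lt_trans H.
rewrite lee_fin ler_wpM2r//; last by apply: powR_ler => //; exact: ltW.
by rewrite exprn_ge0// ltW// is_cube_dilate.
Qed.

Lemma in_Stop m t P : P \in Stop m t ->
  [/\ bad t P, is_cube P & cubeset P `<=` cubeset Q].
Proof. by rewrite mem_undup; exact: stop_sub. Qed.

Lemma Stop_triv m t : trivIset [set` Stop m t] (fun P => cubeset P).
Proof.
by move=> P P' /=; rewrite !mem_undup; exact: (stop_triv Q0).
Qed.

Lemma vol_ge0 P : is_cube P -> 0 <= vol P.
Proof. by move=> P0; rewrite exprn_ge0// ltW. Qed.

Lemma vol_dilate (c : R) P : vol (dilate c P) = c ^+ n * vol P.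
Proof. by rewrite side_dilate exprMn. Qed.

Lemma measurable2 P : measurable (cubeset (dilate 2 P)).
Proof. exact: measurable_cubeset. Qed.

Lemma Nvol_ge0 m t : 0 <= Nvol m t.
Proof.
rewrite /Nvol big_seq; apply: sumr_ge0 => P /in_Stop[_ P0 _]; exact: vol_ge0.
Qed.

Lemma Nvol_le m t : Nvol m t <= vol Q.
Proof.
apply: (@sum_vol_le _ _ id) => //; last 3 first.
- exact: undup_uniq.
- exact: Stop_triv.
- by move=> P /in_Stop[].
- by move=> P /in_Stop[].
Qed.

(** The parent is not bad, its double contains that of [P], and its volume is 2^n times larger;
    hence 2^(n/p) after a p-th root. The parent exists because [gQ] prevents [Q] itself from being
    bad at levels t >= a(2Q). *)
Lemma Stop_avg m t P : 0 < t -> a (dilate 2 Q) <= t -> P \in Stop m t ->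
  (Ip p (cubeset (dilate 2 P)) g <= ((2 `^ (n%:R / p) * t) `^ p * vol (dilate 2 P))%:E)%E.
Proof.
move=> t0 at0 PS; have [_ P0 PQ] := in_Stop PS.
have bQ : ~~ bad t Q.
  apply/asboolPn/negP; rewrite -leNgt; apply: le_trans gQ _; rewrite lee_fin.
  apply: ler_wpM2r; first by apply: vol_ge0; exact: is_cube_dilate.
  by apply: powR_ler => //; [exact: ltW|apply: a0; exact: is_cube_dilate].
move: PS; rewrite mem_undup => /(stop_parent Q0 bQ)[P' [P'0 PP' P'Q /asboolPn/negP]].
rewrite -leNgt => H sP'; apply: le_trans (le_trans _ H) _.
  apply: ge0_integralS; try exact: measurable2.
  - exact: measurable_norm_powR.
  - by move=> x; rewrite lee_fin powR_ge0.
  - exact: dilate2_sub.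
rewrite lee_fin powRM ?powR_ge0//; last exact: ltW.
rewrite -powRrM divfK ?gt_eqF// powR_mulrn//.
rewrite !vol_dilate sP' exprMn le_eqVlt; apply/orP; left; apply/eqP; ring.
Qed.

(* The first summand comes from [u], the second from [v], in the splitting [g = u + v]. *)
Definition goodc (L e : R) : R := 3 ^+ n * 2 ^+ n * (2 * 2 `^ p) *
  (e `^ p * L `^ (- p) + 4 `^ (r - p) * (K * 2 `^ (n%:R / p)) `^ r * L `^ (- r)).

Lemma goodc_ge0 L e : 0 <= e -> 0 <= goodc L e.
Proof.
by move=> e0; rewrite /goodc !(mulr_ge0, addr_ge0, powR_ge0, exprn_ge0)// ltW.
Qed.

(** A weak-type estimate localized to 2P. The function [w] below dominates |g|^p up to (L t)^p / 2,
    so on the double of a cube bad at level L t its average is at least (L t)^p / 2. Vitali-selected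
    doubles are disjoint and lie in 2P, so the integral of [w] over 2P bounds their total volume. *)
Lemma small_cube m t L e P : 0 < t -> a (dilate 2 Q) <= t -> 1 <= L -> 0 < e ->
  P \in Stop m t -> a (dilate 2 P) <= e * t ->
  \sum_(P' <- Stop m (L * t) | `[< cubeset P' `<=` cubeset P >]) vol P'
    <= goodc L e * vol P.
Proof.
move=> t0 at0 L1 e0 PS aP; have [_ P0 PQ] := in_Stop PS.
have gP := Stop_avg t0 at0 PS.
have [u [v [mu mv guv uP vP]]] := gsplit P0 PQ.
have L0 : 0 < L by exact: lt_le_trans L1.
have Lt0 : 0 < L * t by rewrite mulr_gt0.
have k0 : 0 < 2 `^ (n%:R / p) * t by rewrite mulr_gt0// powR_gt0.
have {}vP := vP _ k0 gP.
pose s := [seq P' <- Stop m (L * t) | `[< cubeset P' `<=` cubeset P >]].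
have sP P' : P' \in s -> [/\ bad (L * t) P', is_cube P' & cubeset P' `<=` cubeset P].
  by rewrite mem_filter => /andP[/asboolP H /in_Stop[]].
have us : uniq s by apply: filter_uniq; exact: undup_uniq.
have [|s' [us' ss' ts' cs']] := @vitali_cubes _ _ (dilate 2) s.
  by move=> P' /sP[_ ? _]; exact: is_cube_dilate.
(* With this height 2^p sg^p = (L t / 2)^p, at most (L t)^p / 2 because 1 <= p: the constant term of
   [powR_split] uses up only half of the threshold. *)
pose sg := L * t / 4.
have sg0 : 0 < sg by rewrite divr_gt0.
pose w (x : n.-tuple R) : \bar R := ((2 `^ p)%:E * ((`|u x| `^ p)%:E + (sg `^ (p - r))%:E * (`|v x| `^ r)%:E))%E.
have w0 x : (0 <= w x)%E.
  by rewrite /w mule_ge0 ?adde_ge0 ?mule_ge0 ?lee_fin ?powR_ge0.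
have mw : measurable_fun setT w.
  apply: measurable_funeM; apply: emeasurable_funD; first exact: measurable_norm_powR.
  by apply: measurable_funeM; exact: measurable_norm_powR.
have wP : (\int[leb]_(x in cubeset (dilate 2 P)) w x <=
    (2 `^ p * ((e * t) `^ p + sg `^ (p - r) * (K * (2 `^ (n%:R / p) * t)) `^ r)
      * vol (dilate 2 P))%:E)%E.
  rewrite ge0_integralZl; last 4 first.
  - exact: measurable2.
  - apply: emeasurable_funD; first exact: measurable_norm_powR.
    by apply: measurable_funeM; exact: measurable_norm_powR.
  - by move=> x _; rewrite adde_ge0 ?mule_ge0 ?lee_fin ?powR_ge0.
  - by rewrite lee_fin powR_ge0.
  rewrite ge0_integralD; last 5 first.
  - exact: measurable2.
  - by move=> x _; rewrite lee_fin powR_ge0.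
  - exact: measurable_norm_powR.
  - by move=> x _; rewrite mule_ge0 ?lee_fin ?powR_ge0.
  - by apply: measurable_funeM; exact: measurable_norm_powR.
  rewrite ge0_integralZl; last 4 first.
  - exact: measurable2.
  - exact: measurable_norm_powR.
  - by move=> x _; rewrite lee_fin powR_ge0.
  - by rewrite lee_fin powR_ge0.
  rewrite -mulrA EFinM; apply: lee_wpmul2l; first by rewrite lee_fin powR_ge0.
  rewrite mulrDl EFinD; apply: leeD.
    apply: le_trans uP _; rewrite lee_fin ler_wpM2r//.
      by apply: vol_ge0; exact: is_cube_dilate.
    by apply: powR_ler => //; [exact: ltW|apply: a0; exact: is_cube_dilate].
  by rewrite -mulrA EFinM; apply: lee_wpmul2l => //; rewrite lee_fin powR_ge0.
have half P' : P' \in s' -> (((L * t) `^ p / 2 * vol (dilate 2 P'))%:E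
    <= \int[leb]_(x in cubeset (dilate 2 P')) w x)%E.
  move=> /ss'/sP[/asboolP bP' P'0 P'P].
  have d2P' : is_cube (dilate 2 P') by exact: is_cube_dilate.
  have H : (Ip p (cubeset (dilate 2 P')) g <= ((L * t) `^ p / 2 * vol (dilate 2 P'))%:E +
      \int[leb]_(x in cubeset (dilate 2 P')) w x)%E.
    rewrite EFinM -lebRn_cubeset; last exact: ltW.
    rewrite -integral_cst; last exact: measurable2.
    rewrite -ge0_integralD; last 5 first.
    - exact: measurable2.
    - by move=> x _; rewrite lee_fin divr_ge0// powR_ge0.
    - exact: measurable_cst.
    - by move=> x _; exact: w0.
    - exact: measurable_funTS.
    apply: ae_on_le_integral.
    - exact: measurable2.
    - exact: measurable_norm_powR.
    - by apply: emeasurable_funD; [exact: measurable_cst|exact: measurable_funTS].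
    - by move=> x _; rewrite lee_fin powR_ge0.
    - by move=> x _; rewrite adde_ge0// lee_fin divr_ge0// powR_ge0.
    apply: ae_on_imply (ae_onS (dilate2_sub P'0 P'P) guv) => x _ gx.
    have -> : w x = (2 `^ p * (`|u x| `^ p + sg `^ (p - r) * `|v x| `^ r))%:E by [].
    rewrite -EFinD lee_fin.
    have := @powR_split _ p r sg `|u x| `|v x| `|g x| p0 pr sg0.
    rewrite gx ler_normD => /(_ _ _ _ isT); rewrite !normr_ge0 => /(_ isT isT isT) H.
    apply: le_trans H _.
    have : 2 `^ p * sg `^ p <= (L * t) `^ p / 2.
      rewrite -powRM//; last exact: ltW.
      rewrite (_ : 2 * sg = L * t * 2^-1); last by rewrite /sg; field.
      rewrite powRM//; last exact: ltW.
      apply: ler_wpM2l; first exact: powR_ge0.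
      by apply: ge1r_powR => //; apply/andP; split; [|lra].
    lra.
  have fin : (\int[leb]_(x in cubeset (dilate 2 P')) w x)%E \is a fin_num.
    rewrite ge0_fin_numE; last by apply: integral_ge0 => x _; exact: w0.
    apply: le_lt_trans (le_lt_trans wP (ltry _)).
    apply: ge0_integralS => //; try exact: measurable2.
    exact: dilate2_sub.
  have := lt_le_trans bP' H; rewrite -(fineK fin) -EFinD lte_fin lee_fin; lra.
have main : (L * t) `^ p / 2 * \sum_(P' <- s') vol (dilate 2 P') <=
  2 `^ p * ((e * t) `^ p + sg `^ (p - r) * (K * (2 `^ (n%:R / p) * t)) `^ r)
      * vol (dilate 2 P).
  rewrite -lee_fin; apply: le_trans wP.
  apply: (@le_trans _ _ (\sum_(P' <- s') \int[leb]_(x in cubeset (dilate 2 P')) w x)%E).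
    rewrite mulr_sumr -sumEFin big_seq [leRHS]big_seq; apply: lee_sum => P'; exact: half.
  apply: sum_integral_le => //; first exact: measurable2.
  by move=> P' /ss'/sP[_ P'0 P'P]; exact: dilate2_sub.
have cov : \sum_(P' <- s) vol P' <= 3 ^+ n * \sum_(P' <- s') vol (dilate 2 P').
  have -> : 3 ^+ n * \sum_(P' <- s') vol (dilate 2 P') =
      \sum_(P' <- s') vol (dilate 3 (dilate 2 P')).
    by rewrite mulr_sumr; apply: eq_bigr => P' _; rewrite [RHS]vol_dilate.
  apply: (@sum_vol_cover _ _ id) => //.
  - by move=> P' /sP[].
  - by move=> P' /ss'/sP[_ ? _]; do 2!apply: is_cube_dilate => //.
  - by apply: sub_trivIset (@Stop_triv m (L * t)) => P' /=; rewrite mem_filter => /andP[].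
  - move=> P' P's; have [P'' H1 H2] := cs' _ P's; exists P'' => //.
    apply: subset_trans H2; apply: cubeset_dilate; last by lra.
    by have [] := sP _ P's.
rewrite -big_filter; apply: le_trans cov _.
have Ltp : 0 < (L * t) `^ p by rewrite powR_gt0.
(* The powers of t cancel by homogeneity. In [goodc], 3^n is the Vitali loss, 2^n the volume ratio
   of 2P to P, the factor 2 comes from the half threshold, and 4^(r - p) from [sg]. *)
have -> : goodc L e * vol P = 3 ^+ n * (2 * ((L * t) `^ p)^-1 *
  (2 `^ p * ((e * t) `^ p + sg `^ (p - r) * (K * (2 `^ (n%:R / p) * t)) `^ r)
      * vol (dilate 2 P))).
  have pw0 (y z : R) : 0 < y -> y `^ z != 0 by move=> ?; rewrite gt_eqF ?powR_gt0.
  rewrite /goodc vol_dilate /sg.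
  have ne0 y : 0 < y -> (y != 0 :> R) by move=> ?; rewrite gt_eqF.
  rewrite !powRM ?(mulr_ge0, powR_ge0, ltW) ?invr_gt0//.
  have -> : (4^-1) `^ (p - r) = 4 `^ (r - p) :> R.
    by rewrite -[4^-1]powR_inv1// -powRrM mulN1r opprB.
  rewrite !powRB ?ne0 ?implybT// !powRN.
  have := (pw0 _ r L0, pw0 _ p L0, pw0 _ r t0, pw0 _ p t0).
  move=> [[[? ?] ?] ?]; field.
  by rewrite !pw0//.
apply: ler_wpM2l; first by rewrite exprn_ge0.
rewrite -ler_pdivrMl; last by rewrite mulr_gt0// invr_gt0.
apply: le_trans main; rewrite le_eqVlt; apply/orP; left; apply/eqP; field.
by rewrite gt_eqF.
Qed.

(** Chebyshev's inequality for the weights a(2P)^q: each of these cubes has 1 <= (a(2P) / (e t))^q,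
    and [aD] sums the right-hand sides over a subfamily with disjoint doubles. *)
Lemma big_cubes m t e : 0 < t -> 0 < e ->
  \sum_(P <- Stop m t | e * t < a (dilate 2 P)) vol P <=
  3 ^+ n * (e * t) `^ (- q) * (CD * a (dilate 2 Q) `^ q * vol (dilate 2 Q)).
Proof.
move=> t0 e0; rewrite -big_filter.
set s := [seq P <- _ | _].
have sP P : P \in s -> [/\ e * t < a (dilate 2 P), is_cube P & cubeset P `<=` cubeset Q].
  by rewrite mem_filter => /andP[? /in_Stop[]].
have [|s' [us' ss' ts' cs']] := @vitali_cubes _ _ (dilate 2) s.
  by move=> P' /sP[_ ? _]; exact: is_cube_dilate.
apply: (@le_trans _ _ (\sum_(P <- s') vol (dilate 3 (dilate 2 P)))).
  apply: (@sum_vol_cover _ _ id) => //.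
  - by move=> P' /sP[].
  - by move=> P' /ss'/sP[_ ? _]; do 2!apply: is_cube_dilate => //.
  - by apply: filter_uniq; exact: undup_uniq.
  - by apply: sub_trivIset (@Stop_triv m t) => P' /=; rewrite mem_filter => /andP[].
  - move=> P' P's; have [P'' H1 H2] := cs' _ P's; exists P'' => //.
    apply: subset_trans H2; apply: cubeset_dilate; last by lra.
    by have [] := sP _ P's.
have et0 : 0 < e * t by rewrite mulr_gt0.
have q0 : 0 < q by exact: lt_trans pq.
apply: (@le_trans _ _ (3 ^+ n * (e * t) `^ (- q) *
    \sum_(P <- s') a (dilate 2 P) `^ q * vol (dilate 2 P))); last first.
  apply: ler_wpM2l; first by rewrite mulr_ge0 ?powR_ge0// exprn_ge0.
  by apply: aD => // P /ss'/sP[].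
rewrite mulr_sumr big_seq [leRHS]big_seq; apply: ler_sum => P /ss'/sP[aP P0 PQ].
rewrite vol_dilate -mulrA ler_wpM2l ?exprn_ge0// mulrA ler_peMl//.
  by apply: vol_ge0; exact: is_cube_dilate.
rewrite powRN -ler_pdivrMl ?invr_gt0 ?powR_gt0// mulr1 invrK.
by apply: powR_ler; exact: ltW.
Qed.

(** Every cube stopped at level L t lies in one stopped at level t, so volumes are counted inside
    each of the latter: by [small_cube] if a(2P) <= e t, and otherwise by the whole volume of P,
    summed in [big_cubes]. *)
Lemma good_lambda m t L e : 0 < t -> a (dilate 2 Q) <= t -> 1 <= L -> 0 < e ->
  Nvol m (L * t) <= goodc L e * Nvol m t +
    3 ^+ n * (e * t) `^ (- q) * (CD * a (dilate 2 Q) `^ q * vol (dilate 2 Q)).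
Proof.
move=> t0 at0 L1 e0; have L0 : 0 < L by exact: lt_le_trans L1.
have tLt : t <= L * t by rewrite ler_peMl// ltW.
apply: (@le_trans _ _ (\sum_(P <- Stop m t)
    \sum_(P' <- Stop m (L * t) | `[< cubeset P' `<=` cubeset P >]) vol P')).
  rewrite (exchange_big_dep predT)//= /Nvol big_seq [leRHS]big_seq.
  apply: ler_sum => P' P'S; have [bP' P'0 P'Q] := in_Stop P'S.
  have [| |P PS P'P] := @stop_mono _ _ (bad t) (bad (L * t)) m Q P' Q0.
  - by move=> P P0; exact: bad_le.
  - by rewrite -mem_undup.
  rewrite -mem_undup in PS.
  rewrite (big_rem P)//= asboolT//= lerDl big_seq_cond; apply: sumr_ge0 => i _.
  exact: vol_ge0.
rewrite (bigID (fun P => e * t < a (dilate 2 P)))/= addrC; apply: lerD.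
  rewrite /Nvol mulr_sumr [leRHS](bigID (fun P => e * t < a (dilate 2 P)))/=.
  rewrite [leRHS]addrC -[leLHS]addr0; apply: lerD; last first.
    rewrite big_seq_cond; apply: sumr_ge0 => P /andP[/in_Stop[_ P0 _] _].
    by rewrite mulr_ge0 ?vol_ge0// goodc_ge0// ltW.
  rewrite big_seq_cond [leRHS]big_seq_cond; apply: ler_sum => P /andP[PS].
  by rewrite -leNgt => aP; exact: small_cube.
apply: le_trans (big_cubes m t0 e0).
rewrite big_seq_cond [leRHS]big_seq_cond; apply: ler_sum => P /andP[PS _].
have [_ P0 PQ] := in_Stop PS.
rewrite -big_filter; apply: (@sum_vol_le _ _ id) => //.
- by move=> P'; rewrite mem_filter => /andP[_ /in_Stop[]].
- by apply: filter_uniq; exact: undup_uniq.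
- by apply: sub_trivIset (@Stop_triv m (L * t)) => P' /=; rewrite mem_filter => /andP[].
- by move=> P'; rewrite mem_filter => /andP[/asboolP].
Qed.

(** Here the integral of |g|^p over 2Q is zero, so no subcube is bad. The case is separate because
    the levels A L^k only reach every t when A > 0. *)
Lemma Nvol_eq0 m t : a (dilate 2 Q) = 0 -> 0 < t -> Nvol m t = 0.
Proof.
move=> aQ0 t0; rewrite /Nvol big_seq big1// => P /in_Stop[/asboolP bP P0 PQ].
exfalso; move: bP; apply/negP; rewrite -leNgt.
apply: (@le_trans _ _ 0%E); last first.
  by rewrite lee_fin mulr_ge0 ?powR_ge0// vol_ge0//; exact: is_cube_dilate.
have := gQ; rewrite aQ0 powR0 ?gt_eqF// mul0r; apply: le_trans.
apply: ge0_integralS; try exact: measurable2.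
- exact: measurable_norm_powR.
- by move=> x; rewrite lee_fin powR_ge0.
- exact: dilate2_sub.
Qed.

(** Induction on k for t <= A L^(k+1), where A = a(2Q). Up to A L the bound |Omega_t| <= |Q| is
    enough; above, t = L s with s >= A, and the good-lambda inequality multiplied by t^q gives at
    most W / 2 from level s and W / 2 from the D_q term. *)
Lemma Nvol_bound m t L e : 0 < t -> 1 < L -> 0 < e -> 0 <= CD ->
  goodc L e * L `^ q <= 1 / 2 ->
  t `^ q * Nvol m t <= (L `^ q + 2 * L `^ q * (6 ^+ n * e `^ (- q) * CD)) *
    (a (dilate 2 Q) `^ q * vol Q).
Proof.
move=> t0 L1 e0 CD0 cL; have L0 : 0 < L by exact: lt_trans L1.
have q0 : 0 < q by exact: lt_trans pq.
have aQ0 := a0 (is_cube_dilate (ltr0Sn _ 1) Q0).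
have B0 : 0 <= 6 ^+ n * e `^ (- q) * CD.
  by rewrite !mulr_ge0 ?exprn_ge0 ?powR_ge0.
move: aQ0; rewrite le_eqVlt => /orP[/eqP aQ0|A0].
  rewrite Nvol_eq0// mulr0 mulr_ge0//; last by rewrite mulr_ge0 ?powR_ge0// vol_ge0.
  by rewrite addr_ge0 ?mulr_ge0 ?powR_ge0.
set A := a (dilate 2 Q) in A0 *; set W := leRHS.
have W1 : L `^ q * (A `^ q * vol Q) <= W.
  rewrite /W mulrDl lerDl !mulr_ge0 ?powR_ge0//; exact: vol_ge0.
(* The factor 2 in the constant reserves half of [W] for the D_q term; the summand L^q pays for the
   base case. *)
have W2 : 2 * (L `^ q * (6 ^+ n * e `^ (- q) * CD * (A `^ q * vol Q))) <= W.
  rewrite [leLHS](_ : _ = 2 * L `^ q * (6 ^+ n * e `^ (- q) * CD) * (A `^ q * vol Q));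
    last by ring.
  rewrite /W [leRHS]mulrDl lerDr; apply: mulr_ge0; first by rewrite powR_ge0.
  by rewrite mulr_ge0 ?powR_ge0// vol_ge0.
have base t' : 0 < t' -> t' <= A * L -> t' `^ q * Nvol m t' <= W.
  move=> t'0 t'A; apply: le_trans W1; rewrite mulrA.
  apply: ler_pM; rewrite ?powR_ge0 ?Nvol_ge0 ?Nvol_le//.
  rewrite -powRM ?(ltW L0) ?(ltW A0)//.
  by apply: powR_ler; [exact: ltW|exact: ltW|rewrite mulrC].
have step k t' : 0 < t' -> t' <= A * L ^+ k.+1 -> t' `^ q * Nvol m t' <= W.
  elim: k t' => [|k IH] t' t'0; first by rewrite expr1; exact: base.
  move=> t'A; have [/(base _ t'0)//|At'] := leP t' (A * L).
  pose s := t' / L; have t'E : t' = L * s by rewrite /s mulrC divfK// gt_eqF.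
  have s0 : 0 < s by rewrite divr_gt0.
  have As : A <= s by rewrite /s ler_pdivlMr// ltW.
  have sL : s <= A * L ^+ k.+1 by rewrite /s ler_pdivrMr// -mulrA -exprSr.
  clearbody s; have {}IH := IH _ s0 sL.
  have GL := good_lambda m s0 As (ltW L1) e0.
  have sq0 : 0 < s `^ q by rewrite powR_gt0.
  rewrite t'E powRM ?(ltW L0) ?(ltW s0)//.
  apply: (@le_trans _ _ (L `^ q * s `^ q * (goodc L e * Nvol m s +
     3 ^+ n * (e * s) `^ (- q) * (CD * a (dilate 2 Q) `^ q * vol (dilate 2 Q))))).
    by apply: ler_wpM2l GL; rewrite mulr_ge0 ?powR_ge0.
  rewrite mulrDr.
  have -> : L `^ q * s `^ q * (goodc L e * Nvol m s) =
     (goodc L e * L `^ q) * (s `^ q * Nvol m s) by ring.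
  have -> : L `^ q * s `^ q * (3 ^+ n * (e * s) `^ (- q) *
      (CD * a (dilate 2 Q) `^ q * vol (dilate 2 Q))) =
      L `^ q * (6 ^+ n * e `^ (- q) * CD * (A `^ q * vol Q)).
    rewrite vol_dilate (_ : 6 = 3 * 2 :> R); last by rewrite -natrM.
    rewrite exprMn powRM ?(ltW e0) ?(ltW s0)// -/A !powRN; field.
    by rewrite !gt_eqF ?powR_gt0.
  have : (goodc L e * L `^ q) * (s `^ q * Nvol m s) <= 1 / 2 * W.
    apply: ler_pM => //; rewrite mulr_ge0 ?powR_ge0 ?Nvol_ge0//.
    by rewrite goodc_ge0// ltW.
  by move: W2; lra.
(* Bernoulli's inequality: the powers of L are unbounded, so some A L^(k+1) exceeds the given t. *)
have ber k : 1 + k%:R * (L - 1) <= L ^+ k.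
  elim: k => [|k IH]; first by rewrite mul0r addr0 expr0.
  have H : L * (1 + k%:R * (L - 1)) <= L * L ^+ k by rewrite ler_wpM2l// ltW.
  have k0 : 0 <= k%:R * (L - 1) ^+ 2 by rewrite mulr_ge0// sqr_ge0.
  rewrite exprS; apply: le_trans H; rewrite -natr1; move: k0; rewrite expr2; lra.
pose k := Num.Def.truncn (t / A / (L - 1)).
apply: (step k) => //; rewrite mulrC -ler_pdivrMr//; apply: le_trans (ber _).
have : t / A / (L - 1) < k.+1%:R by exact: truncnS_gt.
by rewrite ltr_pdivrMr ?subr_gt0//; lra.
Qed.

End good_lambda.

(** * Level sets *)

Section level_sets.
Context {R : realType} {n : nat}.
Local Notation leb := (@lebRn R n).
Local Notation vol P := (side P ^+ n).
Local Notation Ip p E g := (\int[leb]_(x in E) (`|g x| `^ p)%:E)%E.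
Implicit Types P Q : @cube R n.

Definition level (g : n.-tuple R -> R) (t : R) : set (n.-tuple R) :=
  [set x | t < `|g x|].

Lemma measurable_level g t : measurable_fun setT g -> measurable (level g t).
Proof.
move=> mg; rewrite -[X in measurable X]setTI.
rewrite (_ : level g t = (fun x => `|g x|) @^-1` `]t, +oo[%classic); last first.
  by apply/seteqP; split=> x; rewrite /level /= in_itv /= andbT.
have mn : measurable_fun setT (fun x => `|g x|) by exact: measurableT_comp.
exact: mn.
Qed.

Lemma leb_cubeI_fin Q (E : set (n.-tuple R)) : is_cube Q -> measurable E ->
  leb (cubeset Q `&` E) \is a fin_num.
Proof.
move=> Q0 mE; rewrite ge0_fin_numE//; apply: (@le_lt_trans _ _ (leb (cubeset Q))).
  apply: le_measure; rewrite ?inE; [|exact: measurable_cubeset|exact: subIsetl].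
  by apply: measurableI => //; exact: measurable_cubeset.
by rewrite lebRn_cubeset ?ltry// ltW.
Qed.

(** Chebyshev's inequality. The p-th power of the factor in the threshold is 2^(-n) / 2: the 2^(-n)
    compensates the volume of 2P against that of P, and the 1/2 leaves at most half of P to the
    level set. *)
Lemma level_cube_le p (g : n.-tuple R -> R) t P : measurable_fun setT g ->
  0 < p -> 0 < t -> is_cube P ->
  ~~ bad p g (2 `^ (- n.+1%:R / p) * t) P ->
  (leb (cubeset P `&` level g t) <= (vol P / 2)%:E)%E.
Proof.
move=> mg p0 t0 P0 /asboolPn/negP; rewrite -leNgt => H.
have mPE : measurable (cubeset P `&` level g t).
  by apply: measurableI; [exact: measurable_cubeset|exact: measurable_level].
have fin := leb_cubeI_fin P0 (measurable_level t mg).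
have C : ((t `^ p)%:E * leb (cubeset P `&` level g t) <= Ip p (cubeset (dilate 2 P)) g)%E.
  rewrite -integral_cst//; apply: (@le_trans _ _ (Ip p (cubeset P `&` level g t) g)).
    apply: ge0_le_integral => //.
    - by move=> x _; rewrite lee_fin powR_ge0.
    - exact: measurable_norm_powR.
    - move=> x [_ /ltW tg]; rewrite lee_fin; apply: powR_ler => //; exact: ltW.
  apply: ge0_integralS => //.
  - exact: measurable_cubeset.
  - exact: measurable_norm_powR.
  - by move=> x [Px _]; apply: cubeset_dilate Px => //; lra.
have := le_trans C H; rewrite -(fineK fin) -EFinM !lee_fin.
rewrite powRM ?powR_ge0//; last exact: ltW.
rewrite -powRrM divfK ?gt_eqF// powRN powR_mulrn// side_dilate exprMn exprS.
rewrite [X in _ <= X -> _](_ : _ = t `^ p * (vol P / 2)); last first.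
  by field; rewrite expf_neq0.
by rewrite ler_pM2l ?powR_gt0.
Qed.

(* Takes the place of Lebesgue's differentiation theorem: the level set is approximated
   by a union of dyadic cubes of one generation. *)
Lemma level_set_le p (g : n.-tuple R -> R) t d Q : measurable_fun setT g ->
  0 < p -> 0 < t -> 0 < d -> is_cube Q ->
  exists m, fine (leb (cubeset Q `&` level g t)) <=
    Nvol p Q g m (2 `^ (- n.+1%:R / p) * t) + 3 * d.
Proof.
move=> mg p0 t0 d0 Q0; set s := (_ * t); have mE := measurable_level t mg.
have mQE : measurable (cubeset Q `&` level g t).
  by apply: measurableI => //; exact: measurable_cubeset.
have [_ /(_ _ d0)[m [D [[mD DD] HD]]]] := measurable_approximable Q0 mE.
exists m; set E := level g t in mE mQE HD *.
have finE := leb_cubeI_fin Q0 mE; have finD := leb_cubeI_fin Q0 mD.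
have mQ := measurable_cubeset Q.
pose G := undup (gen m Q).
have uG : uniq G by exact: undup_uniq.
have Ggen P : P \in G -> P \in gen m Q by rewrite mem_undup.
have GQ P : P \in G -> is_cube P /\ cubeset P `<=` cubeset Q.
  by move=> /Ggen/(gen_sub Q0)[? ? _]; split.
have tG : trivIset [set` G] (fun P => cubeset P).
  by move=> P P' /= /Ggen H /Ggen H'; exact: (gen_triv Q0 H H').
pose inD P := `[< cubeset P `<=` D >].
(* On the remaining cubes inside [D] the level set has density at most 1/2; the cubes of [Gb] are
   covered by stopping cubes. *)
pose Gb := [seq P <- G | inD P && bad p g s P].
have ED : (leb (cubeset Q `&` E) <= leb (cubeset Q `&` (E `&` D)) + d%:E)%E.
  apply: (@le_trans _ _ (leb (cubeset Q `&` (E `&` D)) + leb (cubeset Q `&` (E `+` D)))%E).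
    apply: (le_trans _ (measureU2 _ _ _)); last 2 first.
    - by apply: measurableI => //; exact: measurableI.
    - exact: measurable_setY.
    apply: le_measure; rewrite ?inE//.
      apply: measurableU; last exact: measurable_setY.
      by apply: measurableI => //; exact: measurableI.
    move=> x [Qx Ex]; have [Dx|Dx] := pselect (D x); first by left.
    by right; split=> //; left.
  by apply: leeD => //; exact: ltW.
have DE : (leb (cubeset Q `&` D) <= leb (cubeset Q `&` E) + d%:E)%E.
  apply: (@le_trans _ _ (leb (cubeset Q `&` E) + leb (cubeset Q `&` (E `+` D)))%E).
    apply: (le_trans _ (measureU2 _ _ _)) => //; last exact: measurable_setY.
    apply: le_measure; rewrite ?inE//; first exact: measurableI.
      by apply: measurableU => //; exact: measurable_setY.
    move=> x [Qx Dx]; have [Ex|Ex] := pselect (E x); first by left.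
    by right; split=> //; right.
  by apply: leeD => //; exact: ltW.
have EDsum : (leb (cubeset Q `&` (E `&` D)) <=
    \sum_(P <- G | inD P) leb (cubeset P `&` E))%E.
  rewrite -big_filter; apply: (@le_trans _ _
    (leb (\big[setU/set0]_(P <- [seq P <- G | inD P]) (cubeset P `&` E)))).
    apply: le_measure; rewrite ?inE; first by apply: measurableI => //; exact: measurableI.
      apply: bigsetU_measurable => P _.
      by apply: measurableI => //; exact: measurable_cubeset.
    move=> x [Qx [Ex Dx]]; have [P Pm Px] := gen_cover m Qx.
    rewrite -bigcup_seq; exists P => //=; rewrite mem_filter mem_undup Pm andbT.
    apply/asboolP; case: (DD _ Pm) => // PD.
    by have : (cubeset P `&` D) x by []; rewrite PD.
  elim: [seq P <- G | inD P] => [|P l IH]; first by rewrite !big_nil measure0.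
  rewrite !big_cons; apply: (le_trans (measureU2 _ _ _)).
  - by apply: measurableI => //; exact: measurable_cubeset.
  - apply: bigsetU_measurable => P' _.
    by apply: measurableI => //; exact: measurable_cubeset.
  - by apply: leeD.
have termle P : P \in G -> (leb (cubeset P `&` E) <=
    (vol P / 2 + (if bad p g s P then vol P / 2 else 0))%:E)%E.
  move=> /GQ[P0 PQ]; case: ifPn => bP; last first.
    rewrite addr0.
    exact: (level_cube_le mg p0 t0 P0 bP).
  have -> : vol P / 2 + vol P / 2 = vol P by lra.
  rewrite -(lebRn_cubeset (ltW P0)).
  apply: le_measure; rewrite ?inE; [|exact: measurable_cubeset|exact: subIsetl].
  by apply: measurableI => //; exact: measurable_cubeset.
have sumle : (\sum_(P <- G | inD P) leb (cubeset P `&` E) <=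
    ((\sum_(P <- G | inD P) vol P) / 2 + (\sum_(P <- Gb) vol P) / 2)%:E)%E.
  apply: (@le_trans _ _ (\sum_(P <- G | inD P)
      (vol P / 2 + (if bad p g s P then vol P / 2 else 0))%:E)%E).
    rewrite big_seq_cond [leRHS]big_seq_cond; apply: lee_sum => P /andP[PG _].
    exact: termle.
  rewrite sumEFin lee_fin big_split /= -big_mkcondr /= -!mulr_suml.
  by rewrite /Gb big_filter.
have sumD : ((\sum_(P <- G | inD P) vol P)%:E <= leb (cubeset Q `&` D))%E.
  rewrite -integral_cst1; last exact: measurableI.
  rewrite -big_filter -sumEFin.
  have := @sum_integral_le R n id [seq P <- G | inD P] (cubeset Q `&` D) (cst 1%E).
  move=> /(_ (measurableI _ _ mQ mD) (measurable_cst _) (fun=> lee01)).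
  move=> /(_ (filter_uniq _ uG)) H; apply: le_trans (H _ _); last 2 first.
  - by apply: sub_trivIset tG => P /=; rewrite mem_filter => /andP[].
  - move=> P; rewrite mem_filter => /andP[/asboolP PD /GQ[_ PQ]] x Px.
    by split; [exact: PQ|exact: PD].
  rewrite big_seq [leRHS]big_seq; apply: lee_sum => P.
  rewrite mem_filter => /andP[_ /GQ[P0 _]].
  rewrite integral_cst1; last exact: measurable_cubeset.
  by rewrite lebRn_cubeset// ltW.
have sumb : \sum_(P <- Gb) vol P <= Nvol p Q g m s.
  apply: (@sum_vol_cover _ _ id id).
  - by move=> P; rewrite mem_filter => /andP[_ /GQ[]].
  - by move=> P /(in_Stop Q0)[].
  - exact: filter_uniq.
  - by apply: sub_trivIset tG => P /=; rewrite mem_filter => /andP[].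
  - move=> P; rewrite mem_filter => /andP[/andP[_ bP] /Ggen Pm].
    have [P' P'S PP'] := gen_stop Q0 Pm bP; exists P' => //.
    by rewrite mem_undup.
(* With N the stopping volume, |E| <= |D|/2 + N/2 + d and |D| <= |E| + d inside [Q]; the density 1/2
   lets |E|/2 be absorbed, which gives |E| <= N + 3d. *)
move: ED DE sumD (le_trans EDsum sumle).
have finED : leb (cubeset Q `&` (E `&` D)) \is a fin_num.
  by apply: leb_cubeI_fin => //; exact: measurableI.
rewrite -(fineK finE) -(fineK finD) -(fineK finED) -!EFinD !lee_fin /=.
move: sumb; rewrite /Gb; lra.
Qed.

End level_sets.

(** * Self-improvement *)

Section self_improvement.
Context {R : realType} {n : nat}.
Local Notation leb := (@lebRn R n).
Local Notation vol P := (side P ^+ n).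
Local Notation Ip p E g := (\int[leb]_(x in E) (`|g x| `^ p)%:E)%E.
Implicit Types P Q : @cube R n.

Lemma goodc_small (p q r K : R) : 1 <= p -> p < q -> q < r -> 0 < K ->
  exists L e, [/\ 1 < L, 0 < e & @goodc R n p r K L e * L `^ q <= 1 / 2].
Proof.
move=> p1 pq qr K0; have p0 : 0 < p by exact: lt_le_trans p1.
have [c1 [X [c10 X0 goodcE]]] : exists c1 X : R, [/\ 0 < c1, 0 < X & forall L e,
    @goodc R n p r K L e = c1 * (e `^ p * L `^ (- p) + X * L `^ (- r))].
  exists (3 ^+ n * 2 ^+ n * (2 * 2 `^ p)), (4 `^ (r - p) * (K * 2 `^ (n%:R / p)) `^ r).
  split; [by rewrite !mulr_gt0 ?exprn_gt0 ?powR_gt0| |by []].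
  by rewrite mulr_gt0 ?powR_gt0// mulr_gt0 ?powR_gt0.
have M0 : 0 < c1 * X by rewrite mulr_gt0.
have rq0 : 0 < r - q by rewrite subr_gt0.
(* Makes the second term c1 X L^(q - r) = c1 X / (4 c1 X + 1), below 1/4; the added 1 forces L >
   1. *)
pose L := (4 * (c1 * X) + 1) `^ (r - q)^-1.
have LE : L `^ (r - q) = 4 * (c1 * X) + 1.
  by rewrite /L -powRrM mulVf ?gt_eqF// powRr1//; lra.
have L1 : 1 < L.
  rewrite ltNge; apply/negP => L1.
  have := powR_ler (ltW rq0) (powR_ge0 _ _) L1; rewrite -/L LE powR1; lra.
have L0 : 0 < L by exact: lt_trans L1.
(* Makes the first term c1 e^p L^(q - p) equal to 1/4, for the [L] already fixed. *)
pose e := (4 * c1 * L `^ (q - p))^-1 `^ p^-1.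
have Lqp : 0 < L `^ (q - p) by rewrite powR_gt0.
have e0 : 0 < e by rewrite powR_gt0// invr_gt0 !mulr_gt0.
have eE : e `^ p = (4 * c1 * L `^ (q - p))^-1.
  by rewrite /e -powRrM mulVf ?gt_eqF// powRr1// invr_ge0 ltW// !mulr_gt0.
clearbody e; clearbody L; exists L, e; split=> //.
rewrite goodcE.
have -> : c1 * (e `^ p * L `^ (- p) + X * L `^ (- r)) * L `^ q =
    c1 * e `^ p * (L `^ (- p) * L `^ q) + c1 * X * (L `^ (- r) * L `^ q) by ring.
have Lne : L != 0 by rewrite gt_eqF.
rewrite -!powRD ?Lne ?implybT// ![- _ + q]addrC -[q - r]opprB powRN LE eE.
have -> : c1 * (4 * c1 * L `^ (q - p))^-1 * L `^ (q - p) = 1 / 4.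
  by field; rewrite !gt_eqF.
have : c1 * X * (4 * (c1 * X) + 1)^-1 <= 1 / 4 by rewrite ler_pdivrMr; lra.
lra.
Qed.

(** The operators have disappeared: only the splittings of one function remain. [C] is chosen before
    [a], [Q] and [g], which is where the uniformity in the theorem comes from. *)
Lemma self_improvement (p q r K CD : R) :
  1 <= p -> p < q -> q < r -> 0 < K -> 0 <= CD ->
  exists C : R, forall (a : @cube R n -> R) Q (g : n.-tuple R -> R),
  (forall P, is_cube P -> 0 <= a P) -> is_cube Q -> measurable_fun setT g ->
  (Ip p (cubeset (dilate 2 Q)) g
     <= (a (dilate 2 Q) `^ p * vol (dilate 2 Q))%:E)%E ->
  (forall P, is_cube P -> cubeset P `<=` cubeset Q ->
    exists u v : n.-tuple R -> R, [/\ measurable_fun setT u, measurable_fun setT v,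
      ae_on (cubeset (dilate 2 P)) (fun x => g x = u x + v x),
      (Ip p (cubeset (dilate 2 P)) u <= (a (dilate 2 P) `^ p * vol (dilate 2 P))%:E)%E &
      forall t : R, 0 < t ->
        (Ip p (cubeset (dilate 2 P)) g <= (t `^ p * vol (dilate 2 P))%:E)%E ->
        (Ip r (cubeset (dilate 2 P)) v <= ((K * t) `^ r * vol (dilate 2 P))%:E)%E]) ->
  (forall s : seq (@cube R n), uniq s ->
    trivIset [set` s] (fun P => cubeset (dilate 2 P)) ->
    (forall P, P \in s -> is_cube P /\ cubeset P `<=` cubeset Q) ->
    \sum_(P <- s) a (dilate 2 P) `^ q * vol (dilate 2 P) <=
      CD * a (dilate 2 Q) `^ q * vol (dilate 2 Q)) ->
  (weaknorm q Q g <= (C * a (dilate 2 Q))%:E)%E.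
Proof.
move=> p1 pq qr K0 CD0; have p0 : 0 < p by exact: lt_le_trans p1.
have q0 : 0 < q by exact: lt_trans pq.
have [L [e [L1 e0 cL]]] := goodc_small p1 pq qr K0.
pose W := L `^ q + 2 * L `^ q * (6 ^+ n * e `^ (- q) * CD).
have W0 : 0 <= W.
  by rewrite /W addr_ge0 ?powR_ge0// !mulr_ge0 ?powR_ge0// exprn_ge0.
pose k : R := 2 `^ (- n.+1%:R / p).
have k0 : 0 < k by rewrite powR_gt0.
exists ((k `^ (- q) * W) `^ q^-1) => a Q g a0 Q0 mg gQ gsplit aD.
have aQ0 : 0 <= a (dilate 2 Q) by apply: a0; exact: is_cube_dilate.
have V0 : 0 < vol Q by rewrite exprn_gt0.
have H (t : R) : 0 < t -> t `^ q * fine (leb (cubeset Q `&` level g t)) <=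
    k `^ (- q) * W * (a (dilate 2 Q) `^ q * vol Q).
  move=> t0; apply/ler_addgt0Pr => d d0.
  have tq0 : 0 < t `^ q by rewrite powR_gt0.
  (* The loss 3 d' of [level_set_le], multiplied by t^q, is then exactly d. The generation m depends
     on d, but the bound on [Nvol] does not depend on m. *)
  have d'0 : 0 < d / (3 * t `^ q) by rewrite divr_gt0// mulr_gt0.
  have [m Hm] := level_set_le mg p0 t0 d'0 Q0.
  have kt0 : 0 < k * t by rewrite mulr_gt0.
  have HN := Nvol_bound p1 pq qr K0 a0 Q0 mg gQ gsplit aD m kt0 L1 e0 CD0 cL.
  rewrite -/W powRM ?(ltW k0) ?(ltW t0)// in HN.
  apply: (le_trans (ler_wpM2l (ltW tq0) Hm)); rewrite -/k mulrDr; apply: lerD.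
    rewrite powRN -!mulrA ler_pdivlMl ?powR_gt0//.
    by move: HN; rewrite -!mulrA.
  by rewrite le_eqVlt; apply/orP; left; apply/eqP; field; rewrite gt_eqF.
clearbody k W; apply: ge_ereal_sup => _ [t t0 <-].
have /= fin := leb_cubeI_fin Q0 (measurable_level t mg).
rewrite (_ : [set x | t < `|g x|] = level g t)// -(fineK fin).
rewrite (lebRn_cubeset (ltW Q0)) /=; set E := fine _.
rewrite (_ : (_ * _)%E = (t * (E / vol Q) `^ q^-1)%:E)// lee_fin.
have E0 : 0 <= E by apply: fine_ge0; exact: measure_ge0.
apply: (@powR_ler_inv _ q) => //.
- by rewrite mulr_ge0 ?powR_ge0// ltW.
- by rewrite mulr_ge0 ?powR_ge0.
have EV0 : 0 <= E / vol Q by rewrite divr_ge0// ltW.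
have kW0 : 0 <= k `^ (- q) * W by rewrite mulr_ge0 ?powR_ge0.
rewrite powRM ?powR_ge0 ?(ltW t0)// [leRHS]powRM ?powR_ge0//.
rewrite -!powRrM !mulVf ?gt_eqF// powRr1// [in leRHS]powRr1//.
by rewrite mulrA ler_pdivrMr// -[leRHS]mulrA; exact: H.
Qed.

End self_improvement.

(** * Averages and local integrability *)

Lemma esum_seq (R : realType) (T : choiceType) (l : seq T) (F : T -> \bar R) :
  uniq l -> (forall x, (0 <= F x)%E) ->
  (\esum_(x in [set` l]) F x = \sum_(x <- l) F x)%E.
Proof.
move=> ul F0; rewrite esum_fset; last by move=> x _; exact: F0.
  exact/esym/fsbig_seq.
exact: finite_seq.
Qed.

Section averages.
Context {R : realType} {n : nat}.
Local Notation leb := (@lebRn R n).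
Local Notation vol P := (side P ^+ n).
Local Notation Ip p E g := (\int[leb]_(x in E) (`|g x| `^ p)%:E)%E.
Implicit Types (P Q : @cube R n) (f g h : n.-tuple R -> R).

Lemma Ip_ge0 p (E : set (n.-tuple R)) g : (0 <= Ip p E g)%E.
Proof. by apply: integral_ge0 => x _; rewrite lee_fin powR_ge0. Qed.

Lemma avgp_le p P g (c : R) : 0 < p -> is_cube P -> 0 <= c ->
  (avgp p (cubeset P) g <= c%:E)%E <-> (Ip p (cubeset P) g <= (c `^ p * vol P)%:E)%E.
Proof.
move=> p0 P0 c0; rewrite /avgp (lebRn_cubeset (ltW P0)) /=.
have V0 : 0 < vol P by rewrite exprn_gt0.
have pV0 : 0 < p^-1 by rewrite invr_gt0.
have := Ip_ge0 p (cubeset P) g; case: (Ip p (cubeset P) g) => [s| |]//= s0.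
  rewrite !lee_fin in s0 *.
  have vs0 : 0 <= (vol P)^-1 * s by rewrite mulr_ge0// invr_ge0 ltW.
  rewrite -ler_pdivrMr// [s / _]mulrC; split=> H.
    have := powR_ler (ltW p0) (powR_ge0 _ _) H.
    by rewrite -powRrM mulVf ?gt_eqF// powRr1.
  have := powR_ler (ltW pV0) vs0 H.
  by rewrite -[X in _ <= X -> _]powRrM mulfV ?gt_eqF// powRr1.
rewrite gt0_muley ?lte_fin ?invr_gt0//= gt_eqF//; split.
Qed.

(** For finite q0, r is q0 itself. For infinite q0 an essential bound controls the average at any
    exponent, and q + 1 is one above q. The gap between c and c' lets an essential bound below c' be
    picked without showing that the infimum is attained. *)
Lemma avgq_le (q : R) (q0 : \bar R) : 0 < q -> (q%:E < q0)%E ->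
  exists2 r, q < r & forall P g (c c' : R), is_cube P -> measurable_fun setT g ->
    0 <= c -> c < c' -> (avgq q0 (cubeset P) g <= c%:E)%E ->
    (Ip r (cubeset P) g <= (c' `^ r * vol P)%:E)%E.
Proof.
move=> q_gt0; case: q0 => [r| |]//=.
  rewrite lte_fin => qr; exists r => // P g c c' P0 mg c0 cc'.
  have r0 : 0 < r by exact: lt_trans qr.
  move=> /avgp_le -/(_ r0 P0 c0) H; apply: le_trans H _.
  rewrite lee_fin ler_wpM2r//; first by rewrite exprn_ge0// ltW.
  by apply: powR_ler => //; exact: ltW.
move=> _; exists (q + 1); first by lra.
move=> P g c c' P0 mg c0 cc' H.
have r0 : 0 < q + 1 by lra.
have : (esssup_on (cubeset P) g < c'%:E)%E by apply: le_lt_trans H _; rewrite lte_fin.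
move=> /ereal_inf_lt[y /= Hy yc'].
rewrite EFinM -(lebRn_cubeset (ltW P0)) -integral_cst; last exact: measurable_cubeset.
apply: ae_on_le_integral.
- exact: measurable_cubeset.
- exact: measurable_norm_powR.
- exact: measurable_cst.
- by move=> x _; rewrite lee_fin powR_ge0.
- by move=> x _; rewrite lee_fin powR_ge0.
apply: ae_on_imply Hy => x _ gy; rewrite lee_fin; apply: powR_ler => //.
  exact: ltW.
by rewrite -lee_fin; apply: le_trans gy (ltW _).
Qed.

Lemma measurable_restr (E : set (n.-tuple R)) f : measurable E ->
  measurable_fun setT f -> measurable_fun setT (restr E f).
Proof.
by move=> mE mf; apply: measurable_funM => //; exact: measurable_indic.
Qed.

Lemma restr_in (E : set (n.-tuple R)) f x : E x -> restr E f x = f x.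
Proof. by move=> Ex; rewrite /restr indicE mem_set// mul1r. Qed.

Lemma restr_notin (E : set (n.-tuple R)) f x : ~ E x -> restr E f x = 0.
Proof. by move=> Ex; rewrite /restr indicE memNset// mul0r. Qed.

Lemma restr_restr (E F : set (n.-tuple R)) f : E `<=` F ->
  restr F (restr E f) = restr E f.
Proof.
move=> EF; apply/funext => x; have [Ex|Ex] := pselect (E x).
  by rewrite restr_in//; exact: EF.
by rewrite {1}/restr !(restr_notin _ Ex) mulr0.
Qed.

Lemma Ip_restr p (E F : set (n.-tuple R)) f : 0 < p -> measurable E ->
  measurable F -> measurable_fun setT f ->
  (Ip p F (restr E f) <= Ip p E f)%E.
Proof.
move=> p0 mE mF mf.
rewrite [leRHS](_ : _ = Ip p setT (restr E f)); last first.
  rewrite integral_mkcond; apply: eq_integral => x _; rewrite patchE.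
  case: ifPn; first by rewrite inE => Ex; rewrite restr_in.
  by rewrite notin_setE => Ex; rewrite restr_notin// normr0 powR0// gt_eqF.
apply: ge0_integralS => //.
apply: measurable_norm_powR; exact: measurable_restr.
Qed.

Lemma Ip_sub p (E : set (n.-tuple R)) f g : 0 < p -> measurable E ->
  measurable_fun setT f -> measurable_fun setT g ->
  (Ip p E f < +oo)%E -> (Ip p E g < +oo)%E ->
  (Ip p E (fun x => f x - g x) < +oo)%E.
Proof.
move=> p0 mE mf mg foo goo.
apply: (@le_lt_trans _ _ ((2 `^ p)%:E * (Ip p E f + Ip p E g))%E); last first.
  by rewrite lte_mul_pinfty ?lee_fin ?powR_ge0// lte_add_pinfty.
rewrite -ge0_integralD; last 5 first.
- exact: mE.
- by move=> x _; rewrite lee_fin powR_ge0.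
- exact: measurable_norm_powR.
- by move=> x _; rewrite lee_fin powR_ge0.
- exact: measurable_norm_powR.
rewrite -ge0_integralZl; last 4 first.
- exact: mE.
- by apply: emeasurable_funD; exact: measurable_norm_powR.
- by move=> x _; rewrite adde_ge0// lee_fin powR_ge0.
- by rewrite lee_fin powR_ge0.
apply: ge0_le_integral => //.
- by apply: measurable_norm_powR; exact: measurable_funB.
- apply: measurable_funeM; apply: emeasurable_funD; exact: measurable_norm_powR.
move=> x _; rewrite (_ : (_ * _)%E = (2 `^ p * (`|f x| `^ p + `|g x| `^ p))%:E)//.
have p02 : 0 <= 2 `^ p :> R by exact: powR_ge0.
have fg : `|f x - g x| <= `|f x| + `|g x| by exact: ler_normB.
rewrite lee_fin; have [xy|yx] := leP `|f x| `|g x|.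
  apply: (@le_trans _ _ ((2 * `|g x|) `^ p)).
    by apply: powR_ler => //; [exact: ltW|lra].
  by rewrite powRM// ler_wpM2l// lerDr powR_ge0.
apply: (@le_trans _ _ ((2 * `|f x|) `^ p)).
  by apply: powR_ler => //; [exact: ltW|lra].
by rewrite powRM// ler_wpM2l// lerDl powR_ge0.
Qed.

Lemma LplocB p f g : 0 < p -> Lploc p f -> Lploc p g ->
  Lploc p (fun x => f x - g x).
Proof.
move=> p0 [mf If] [mg Ig]; split; first exact: measurable_funB.
by move=> Q Q0; apply: Ip_sub => //; [exact: measurable_cubeset|exact: If|exact: Ig].
Qed.

Lemma LplocN p f : Lploc p f -> Lploc p (fun x => -1 * f x).
Proof.
move=> [mf If]; split; first exact: measurable_funM.
by move=> Q /If; congr (_ < _)%E; apply: eq_integral => x _; rewrite mulN1r normrN.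
Qed.

Lemma Lploc_restr p (E : set (n.-tuple R)) f : 0 < p -> measurable E ->
  Lploc p f -> Lploc p (restr E f).
Proof.
move=> p0 mE [mf If]; split; first exact: measurable_restr.
move=> Q Q0; apply: le_lt_trans (If Q Q0); apply: ge0_le_integral => //.
- exact: measurable_cubeset.
- by apply: measurable_norm_powR; exact: measurable_restr.
- exact: measurable_norm_powR.
move=> x _; rewrite lee_fin; apply: powR_ler => //; first exact: ltW.
have [Ex|Ex] := pselect (E x); first by rewrite restr_in.
by rewrite restr_notin// normr0.
Qed.

(** D_q is applied to the doubles inside 2Q. Doubling is injective on the list, since equal doubles
    would meet and disjointness then identifies their indices. *)
Lemma Dq_sum (q : R) (a : @cube R n -> R) : Dq q a ->
  exists2 C, 0 <= C & forall Q (s : seq (@cube R n)), is_cube Q -> uniq s ->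
    trivIset [set` s] (fun P => cubeset (dilate 2 P)) ->
    (forall P, P \in s -> is_cube P /\ cubeset P `<=` cubeset Q) ->
    \sum_(P <- s) a (dilate 2 P) `^ q * vol (dilate 2 P) <=
      C * a (dilate 2 Q) `^ q * vol (dilate 2 Q).
Proof.
move=> [C [C1 H]]; exists (C `^ q); first exact: powR_ge0.
move=> Q s Q0 us ts sQ.
have d2 P : is_cube P -> is_cube (dilate 2 P) by exact: is_cube_dilate.
pose l := [seq dilate 2 P | P <- s].
have ul : uniq l.
  rewrite map_inj_in_uniq// => P P' Ps P's E; apply: ts => //.
  have /d2/corner_cubeset Pc := (sQ _ Ps).1.
  by exists (corner (dilate 2 P)); split=> //; rewrite -E.
have := H _ (d2 _ Q0) [set` l].
rewrite (lebRn_cubeset (ltW (d2 _ Q0))) -EFinM.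
rewrite esum_seq//; last by move=> P; rewrite mule_ge0 ?lee_fin ?powR_ge0.
rewrite big_map => {}H; rewrite -lee_fin; apply: le_trans (H _ _).
- rewrite -sumEFin big_seq [leRHS]big_seq; apply: lee_sum => P /sQ[P0 _].
  by rewrite EFinM (lebRn_cubeset (ltW (d2 _ P0))).
- move=> P /= /mapP[P' /sQ[P'0 P'Q] ->]; split; first exact: d2.
  exact: dilate2_sub.
- move=> P P' /= /mapP[P1 P1s ->] /mapP[P2 P2s ->] neq.
  apply/eqP/negPn/negP => /set0P nE; apply: neq; congr dilate.
  exact: ts.
Qed.

End averages.

(** * The operators *)

Section operators.
Context {R : realType} {n : nat}.
Local Notation leb := (@lebRn R n).
Local Notation vol P := (side P ^+ n).
Local Notation Ip p E g := (\int[leb]_(x in E) (`|g x| `^ p)%:E)%E.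
Implicit Types (P Q : @cube R n) (f g h : n.-tuple R -> R).

Variables (p : R) (B : @cube R n -> (n.-tuple R -> R) -> n.-tuple R -> R).
Hypotheses (p0 : 0 < p) (linB : linear_family p B).
Hypothesis reprA : forall P Q, is_cube P -> is_cube Q -> cubeset P `<=` cubeset Q ->
  forall f, Lploc p f ->
  ae_on (cubeset (dilate 2 P)) (fun x => Aop B P (Aop B Q f) x = Aop B Q f x).
Hypothesis locA : forall Q, is_cube Q -> forall f, Lploc p f ->
  ae_on setT (fun x => Aop B Q f x =
    restr (cubeset (dilate 2 Q)) (Aop B Q (restr (cubeset (dilate 2 Q)) f)) x).

Lemma measurable_Aop Q f : is_cube Q -> Lploc p f ->
  measurable_fun setT (Aop B Q f).
Proof.
move=> Q0 Lf; apply: measurable_funB; first by case: Lf.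
by have [+ _] := linB Q0; exact.
Qed.

(** By locality A_Q f vanishes a.e. off 2Q, so the integral over any cube is at most the one over
    2Q, where both f and B_Q f are p-integrable. *)
Lemma Lploc_Aop Q f : is_cube Q -> Lploc p f ->
  (Ip p (cubeset (dilate 2 Q)) (B Q f) < +oo)%E -> Lploc p (Aop B Q f).
Proof.
move=> Q0 Lf Boo; have mA := measurable_Aop Q0 Lf; split=> // P P0.
have d2Q : is_cube (dilate 2 Q) by exact: is_cube_dilate.
have mB : measurable_fun setT (B Q f) by have [+ _] := linB Q0; exact.
have [mf If] := Lf; have m2 := measurable_cubeset (dilate 2 Q).
have mr := measurable_restr m2 mA.
apply: le_lt_trans (Ip_sub p0 m2 mf mB (If _ d2Q) Boo).
apply: le_trans (Ip_restr p0 m2 (measurable_cubeset P) mA).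
apply: ae_on_le_integral.
- exact: measurable_cubeset.
- exact: measurable_norm_powR.
- exact: measurable_norm_powR.
- by move=> x _; rewrite lee_fin powR_ge0.
- by move=> x _; rewrite lee_fin powR_ge0.
apply: ae_on_imply (ae_onS (@subsetT _ _) (locA Q0 Lf)) => x _ E.
have [Ex|Ex] := pselect (cubeset (dilate 2 Q) x); first by rewrite restr_in.
by rewrite E !restr_notin.
Qed.

Lemma Bop_sub_Aop Q f : B Q f = (fun x => f x - Aop B Q f x).
Proof. by apply/funext => x; rewrite /Aop subKr. Qed.

(* On [2P], [B_P (B_Q f) = B_P f - B_P (A_Q f) = B_P f]. *)
Lemma Bop_Bop P Q f : is_cube P -> is_cube Q -> cubeset P `<=` cubeset Q ->
  Lploc p f -> Lploc p (Aop B Q f) ->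
  ae_on (cubeset (dilate 2 P)) (fun x => B P (B Q f) x = B P f x).
Proof.
move=> P0 Q0 PQ Lf LA; have [_ [addB scaleB]] := linB P0.
rewrite (_ : B Q f = fun y => f y + (-1) * Aop B Q f y); last first.
  by rewrite Bop_sub_Aop; apply/funext => x; rewrite mulN1r.
have H1 := ae_onS (@subsetT _ _) (addB _ _ Lf (LplocN LA)).
have H2 := ae_onS (@subsetT _ _) (scaleB (-1) _ LA).
apply: ae_on_imply (ae_onI (ae_onI (H1 _) (H2 _)) (reprA P0 Q0 PQ Lf)) => x _ /=.
move=> [[-> ->]]; rewrite {1}/Aop => E.
have -> : B P (Aop B Q f) x = 0.
  by move/eqP: E; rewrite subr_eq addrC -subr_eq subrr => /eqP.
by rewrite mulr0 addr0.
Qed.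

End operators.

Theorem mainTheorem5 (R : realType) (n : nat) (p0 q : R) (q0 : \bar R)
  (B : cube n -> (n.-tuple R -> R) -> n.-tuple R -> R) (a : cube n -> R) :
  (0 < n)%N -> 1 <= p0 -> p0 < q -> (q%:E < q0)%E ->
  linear_family p0 B -> cond_b p0 B -> cond_c p0 q0 B ->
  (forall (Rc Q : cube n), is_cube Rc -> is_cube Q -> cubeset Rc `<=` cubeset Q ->
     forall f, Lploc p0 f ->
       ae_on (cubeset (dilate 2 Rc)) (fun x => Aop B Rc (Aop B Q f) x = Aop B Q f x)) ->
  (forall Q : cube n, is_cube Q -> forall f, Lploc p0 f ->
     ae_on setT (fun x =>
       Aop B Q f x = restr (cubeset (dilate 2 Q)) (Aop B Q (restr (cubeset (dilate 2 Q)) f)) x)) ->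
  (forall Q : cube n, is_cube Q -> 0 <= a Q) ->
  Dq q a ->
  exists C : R, forall f : n.-tuple R -> R, Lploc p0 f ->
    (forall Q : cube n, is_cube Q ->
       (avgp p0 (cubeset (dilate 2 Q)) (B Q f) <= (a (dilate 2 Q))%:E)%E) ->
    forall Q : cube n, is_cube Q ->
      (weaknorm q Q (B Q f) <= (C * a (dilate 2 Q))%:E)%E.
Proof.
move=> _ p1 pq qq0 linB _ [alpha [alpha0 [_ condc]]] reprA locA a0 aD.
have p_gt0 : 0 < p0 by exact: lt_le_trans p1.
have q_gt0 : 0 < q by exact: lt_trans pq.
have al0 : 0 <= alpha 2%N by exact: alpha0.
(* The added 1 provides the strict gap that [avgq_le] asks for and keeps K positive when [alpha 2]
   is 0. *)
have K0 : 0 < alpha 2%N + 1 by rewrite ltr_wpDl.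
have [r qr avgr] := @avgq_le R n q q0 q_gt0 qq0.
have [CD CD0 sumD] := Dq_sum aD.
have [C HC] := @self_improvement R n p0 q r _ CD p1 pq qr K0 CD0.
have d2 P : @is_cube R n P -> is_cube (dilate 2 P) by exact: is_cube_dilate.
exists C => f Lf Bf Q Q0.
have IB P : is_cube P -> (\int[@lebRn R n]_(x in cubeset (dilate 2 P)) (`|B P f x| `^ p0)%:E
    <= (a (dilate 2 P) `^ p0 * side (dilate 2 P) ^+ n)%:E)%E.
  by move=> P0; apply/avgp_le => //; [exact: d2|apply: a0; exact: d2|exact: Bf].
have LA : Lploc p0 (Aop B Q f).
  by apply: Lploc_Aop => //; exact: le_lt_trans (IB _ Q0) (ltry _).
have Lg : Lploc p0 (B Q f) by rewrite Bop_sub_Aop; exact: LplocB.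
have [mg _] := Lg.
apply: HC => //; [exact: IB| |by move=> s; exact: sumD].
move=> P P0 PQ; have m2 := measurable_cubeset (dilate 2 P).
have mB : measurable_fun setT (B P f) by have [+ _] := linB _ P0; exact.
(* The first part is [B P f], controlled by a(2P), in place of [B P (B Q f)]; [Bop_Bop] identifies
   the two a.e. on 2P. *)
exists (B P f), (Aop B P (B Q f)); split => //.
- exact (measurable_Aop linB P0 Lg).
- apply: ae_on_imply (Bop_Bop linB reprA P0 Q0 PQ Lf LA) => x _ E.
  by rewrite /Aop E addrC subrK.
- exact: IB.
(* After the cut to 2P the further restriction to 4P in (c) changes nothing, and the average of [h]
   over 4P is at most t: its integral is carried by 2P and 4P is larger. *)
move=> t t0 gt; set h := restr (cubeset (dilate 2 P)) (B Q f).
have Lh : Lploc p0 h by exact: Lploc_restr.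
have P24 : cubeset (dilate 2 P) `<=` cubeset (dilate 4 P).
  by apply: dilate_le => //; rewrite ler_nat.
have [+ _] := condc _ P0 _ Lh; rewrite restr_restr// => Hh.
have d4 : is_cube (dilate 4 P) by exact: is_cube_dilate.
have H4 : (avgp p0 (cubeset (dilate 4 P)) h <= t%:E)%E.
  apply/avgp_le => //; first exact: ltW.
  apply: le_trans (Ip_restr p_gt0 m2 (measurable_cubeset _) mg) _.
  apply: le_trans gt _; rewrite lee_fin ler_wpM2l ?powR_ge0//.
  rewrite !side_dilate; apply: lerXn2r; rewrite ?nnegrE ?mulr_ge0 ?(ltW P0)//.
  by rewrite ler_wpM2r ?(ltW P0)// ler_nat.
have Hv : (avgq q0 (cubeset (dilate 2 P)) (Aop B P h) <= (alpha 2%N * t)%:E)%E.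
  by apply: le_trans Hh _; rewrite EFinM; apply: lee_wpmul2l.
have {}Hv := avgr _ _ _ ((alpha 2%N + 1) * t) (d2 _ P0) (measurable_Aop linB P0 Lh)
  (mulr_ge0 al0 (ltW t0)) (_ : _ < _) Hv.
apply: le_trans (Hv _); last by rewrite ltr_pM2r// ltrDl.
apply: ae_on_le_integral => //.
- by apply: measurable_norm_powR; exact (measurable_Aop linB P0 Lg).
- by apply: measurable_norm_powR; exact (measurable_Aop linB P0 Lh).
(* Locality once more: on 2P, A_P of B_Q f agrees a.e. with A_P of [h]. *)
apply: ae_on_imply (ae_onS (@subsetT _ _) (locA _ P0 _ Lg)) => x Px ->.
by rewrite restr_in.
Qed.
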